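(* Let $\operatorname{char}K\ne2$ and let $\mathbf J=\mathrm{Kan}(\mathbf P)$, generated as a Jordan superalgebra by $V_0,V_1,V_2,\bar1$. Then, with respect to this generating set, $$\mathrm{GKdim}\,\mathbf J=\underline{\mathrm{GKdim}}\,\mathbf J=2\log_\lambda2\approx3.3036,$$ where $\lambda\approx1.5214$ is the real root of $t^3-t-2$.
   Context: $H_\infty=\Lambda(x_i,y_i\mid i\ge0)$ is the Grassmann algebra over $K$ on odd generators with Poisson bracket $\{y_i,x_j\}=\delta_{ij}$, $\{x_i,x_j\}=\{y_i,y_j\}=0$; $\widetilde H$ is its completion by formal sums $c\cdot1+\sum\lambda_{\alpha,\beta}x^\alpha y^\beta$ over monomials with $\beta\ne0$ and (largest index in $\alpha$) $<$ (largest index in $\beta$). $V_i=\sum_{k\ge0}\big(\prod_{n=0}^{k-1}x_{i+3n}x_{i+3n+1}\big)y_{i+3k}$; $\mathbf P$ is the smallest unital subalgebra of $\widetilde H$ containing $V_0,V_1,V_2$ closed under product and bracket. $\mathrm{Kan}(\mathbf P)=\mathbf P\oplus\bar{\mathbf P}$ with $|\bar a|=1-|a|$ and $a\bullet b=ab$, $\bar a\bullet b=(-1)^{|b|}\overline{ab}$, $a\bullet\bar b=\overline{ab}$, $\bar a\bullet\bar b=(-1)^{|b|}\{a,b\}$. The growth function $\gamma(n)$ is the dimension of the span of all Jordan products of at most $n$ generators from $\{V_0,V_1,V_2,\bar1\}$; $\mathrm{GKdim}=\limsup\ln\gamma(n)/\ln n$, $\underline{\mathrm{GKdim}}=\liminf\ln\gamma(n)/\ln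 n$. *)

(* Defs.v *)
From HB Require Import structures.
From mathcomp Require Import all_boot all_order all_algebra.
From mathcomp Require Import all_classical all_reals all_analysis.
Set Implicit Arguments. Unset Strict Implicit. Unset Printing Implicit Defensive.
Import Order.TTheory GRing.Theory Num.Theory.
Local Open Scope ring_scope.

(* Grassmann algebra H_infty = Lambda(x_i, y_i | i >= 0) and its completion. *)
(* A letter is (false, i) = x_i or (true, i) = y_i.  Letters are totally     *)
(* ordered: all x's before all y's, each block by increasing index, so the   *)
(* canonical (sorted) word of a monomial is x^alpha y^beta as in the paper.  *)
Definition letter := (bool * nat)%type.
Definition mono := seq letter.

Definition lt_letter (a b : letter) : bool :=
  (~~ a.1 && b.1) || ((a.1 == b.1) && (a.2 < b.2)%N).

Definition canon (m : mono) : bool := sorted lt_letter m.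

(* formal (possibly infinite) K-linear combinations of canonical monomials:
   an element is its coefficient function (meaningful on canonical words) *)
Definition elt (K : fieldType) := mono -> K.

Section Grassmann.
Variable K : fieldType.

Fixpoint bitseqs (n : nat) : seq bitseq :=
  if n is n'.+1 then [seq b :: s | b <- [:: true; false], s <- bitseqs n']
  else [:: [::]].

(* number of pairs i < j with ms_i = false and ms_j = true: the sign of the
   shuffle (mask ms m) ++ (mask (~ms) m) -> m is (-1)^(shuffle_inv ms) *)
Fixpoint shuffle_inv (ms : bitseq) : nat :=
  if ms is b :: s then ((if b then 0 else count id s) + shuffle_inv s)%N else 0%N.

Definition e_one : elt K := fun m => (m == [::])%:R.
Definition e_zero : elt K := fun _ => 0.
Definition e_add (f g : elt K) : elt K := fun m => f m + g m.
Definition e_scale (c : K) (f : elt K) : elt K := fun m => c * f m.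

Definition e_mul (f g : elt K) : elt K := fun m =>
  if canon m then
    \sum_(ms <- bitseqs (size m))
       (-1) ^+ shuffle_inv ms * f (mask ms m) * g (mask (map negb ms) m)
  else 0.

Definition e_sigma (f : elt K) : elt K := fun m => (-1) ^+ size m * f m.

Fixpoint ins (l : letter) (s : mono) : mono :=
  if s is a :: s' then (if lt_letter a l then a :: ins l s' else l :: s)
  else [:: l].
Definition pos (l : letter) (s : mono) : nat := count (fun a => lt_letter a l) s.

(* left superderivative-based coefficient of  d_{l1}(u) d_{l2}(v)  where
   u = m1 + l1, v = m2 + l2 *)
Definition dterm (f g : elt K) (l1 l2 : letter) (m1 m2 : mono) : K :=
  if (l1 \notin m1) && (l2 \notin m2) then
    (-1) ^+ (pos l1 m1 + pos l2 m2) * f (ins l1 m1) * g (ins l2 m2)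
  else 0.

Definition bnd (m : mono) : nat := (foldr maxn 0%N (map snd m)).+1.

(* Poisson bracket with {y_i, x_j} = delta_ij:
   {a,b} = (-1)^(|a|-1) sum_i (d_{x_i} a d_{y_i} b + d_{y_i} a d_{x_i} b)
   for homogeneous a, extended bilinearly.  The index i is summed over
   i < bnd m; on elements of the completion H~ all other indices contribute
   0, so this is the bracket of H~. *)
Definition e_br (f g : elt K) : elt K := fun m =>
  if canon m then
    \sum_(ms <- bitseqs (size m))
     \sum_(i <- iota 0 (bnd m))
       let m1 := mask ms m in let m2 := mask (map negb ms) m in
       (-1) ^+ shuffle_inv ms * (-1) ^+ size m1 *
       (dterm f g (false, i) (true, i) m1 m2 + dterm f g (true, i) (false, i) m1 m2)
  else 0.

(* V_i = sum_k (prod_{n<k} x_{i+3n} x_{i+3n+1}) y_{i+3k} *)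
Definition vword (i k : nat) : mono :=
  [seq (false, (i + 3 * n + e)%N) | n <- iota 0 k, e <- [:: 0%N; 1%N]]
    ++ [:: (true, (i + 3 * k)%N)].
Definition V (i : nat) : elt K := fun m =>
  (has (fun k => m == vword i k) (iota 0 (size m).+1))%:R.

(* Kantor double Kan(P) = P (+) bar P ; a pair (a, b) stands for a + bar b. *)
(*   a.b = ab, bar a.b = (-1)^|b| bar(ab), a.bar b = bar(ab),               *)
(*   bar a . bar b = (-1)^|b| {a,b}, extended bilinearly.                   *)
Definition kelt := (elt K * elt K)%type.
Definition kmul (p q : kelt) : kelt :=
  (e_add (e_mul p.1 q.1) (e_br p.2 (e_sigma q.2)),
   e_add (e_mul p.2 (e_sigma q.1)) (e_mul p.1 q.2)).

Inductive jword := JGen of nat | JMul of jword & jword.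
Fixpoint jlen (w : jword) : nat :=
  match w with JGen _ => 1%N | JMul u v => (jlen u + jlen v)%N end.
Fixpoint jeval (w : jword) : kelt :=
  match w with
  | JGen i => if (i < 3)%N then (V i, e_zero) else (e_zero, e_one)
  | JMul u v => kmul (jeval u) (jeval v)
  end.
Fixpoint jwords (n : nat) : seq jword :=
  if n is n'.+1 then
    [seq JGen i | i <- iota 0 4] ++
    [seq w <- allpairs JMul (jwords n') (jwords n') | (jlen w <= n'.+1)%N]
  else [::].

Definition lin_indep (s : seq kelt) : Prop :=
  forall c : seq K, size c = size s ->
    (forall m, \sum_(p <- zip c s) p.1 * p.2.1 m = 0 /\
               \sum_(p <- zip c s) p.1 * p.2.2 m = 0) ->
    all (fun a => a == 0) c.

Definition span_dim (L : seq kelt) : nat :=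
  \max_(ms <- bitseqs (size L) | `[< lin_indep (mask ms L) >]) size (mask ms L).

Definition gamma (n : nat) : nat := span_dim [seq jeval w | w <- jwords n].

End Grassmann.

Definition GK_ratio (K : fieldType) (R : realType) (n : nat) : \bar R :=
  ((ln ((gamma K n)%:R : R)) / ln (n%:R : R))%:E.

(* Main.v *)
Require Import Defs.
From HB Require Import structures.
From mathcomp Require Import all_boot all_order all_algebra.
From mathcomp Require Import all_classical all_reals all_analysis.
From mathcomp Require Import ring lra zify.
Import Defs.
Set Implicit Arguments. Unset Strict Implicit. Unset Printing Implicit Defensive.
Import Order.TTheory GRing.Theory Num.Theory.
Local Open Scope ring_scope.

(** Extended by antisymmetry to all words, the Grassmann product is the super shuffle
    product, whose left-insertion maps [f |-> f (l :: _)] are superderivations; this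
    yields the Leibniz rule for the bracket, and [V_k = y_k + x_k x_{k+1} V_{k+3}]
    gives all brackets of the [V]'s.

    Give [V_k] the weight [lam^k] and [x_i] the weight [- lam^i].  Since
    [lam^3 = lam + 2], the weight is additive for product and bracket.

    Upper bound: [P] is spanned by products of elements [x^a V_k] with [a] contained
    in [[0, k-2]] and not containing both [k-3] and [k-2].  Such an element has weight
    at least [c lam^k] with [c > 0] (because [lam > 3/2]), so the words of length [n]
    only involve the [x_i] and [V_i] with [i < M], where [lam^M ~ n]; these generate a
    space of dimension at most [4^M].

    Lower bound: [{x^a V_k, x^b V_k} = +-2 x^a x^b x_{k+1} V_{k+3}],
    [{x^a V_k, V_{k+1}} = - x^a x_k V_{k+3}] and
    [{x^a V_k, x_k V_{k+2}} = x^a V_{k+2}], with [{V_{k+1}, .}] removing [x_{k+1}],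
    produce every [x^a V_{3m+12}] with [a] contained in [[0, 3m-1]] by words of length
    [O(lam^{3m})].  Multiplying by products of [V_j], [j < 3m], gives [4^{3m}]
    independent elements. *)

(** * The super shuffle algebra *)

(** A separate name for functions on all words, sorted or not, so that they can carry the shuffle
    product as ring multiplication instead of the pointwise one. *)
Definition wfun (K : fieldType) : Type := mono -> K.

Section ShuffleAlgebra.
Variable K : fieldType.
Local Notation W := (wfun K).

HB.instance Definition _ := GRing.Zmodule.copy W (mono -> K).

Lemma wfunDE (f g : W) m : (f + g) m = f m + g m. Proof. by []. Qed.
Lemma wfunNE (f : W) m : (- f) m = - f m. Proof. by []. Qed.
Lemma wfun0E m : (0 : W) m = 0. Proof. by []. Qed.

Lemma wfun_sumE (I : Type) (r : seq I) (P : pred I) (F : I -> W) m :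
  (\sum_(i <- r | P i) F i) m = \sum_(i <- r | P i) F i m.
Proof. by elim/big_rec2: _ => // i y1 y2 _ <-. Qed.

Definition wscale (c : K) (f : W) : W := fun m => c * f m.

Lemma wscaleA a b (v : W) : wscale a (wscale b v) = wscale (a * b) v.
Proof. by apply/funext => m; rewrite /wscale mulrA. Qed.
Lemma wscale1 : left_id 1 wscale.
Proof. by move=> v; apply/funext => m; rewrite /wscale mul1r. Qed.
Lemma wscaleDr : right_distributive wscale +%R.
Proof. by move=> c u v; apply/funext => m; rewrite /wscale !wfunDE mulrDr. Qed.
Lemma wscaleDl v : {morph wscale^~ v : a b / a + b}.
Proof. by move=> a b; apply/funext => m; rewrite /wscale wfunDE mulrDl. Qed.

HB.instance Definition _ :=
  GRing.Zmodule_isLmodule.Build K W wscaleA wscale1 wscaleDr wscaleDl.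

Lemma wscaleE c (f : W) m : (c *: f) m = c * f m. Proof. by []. Qed.

Definition der (l : letter) (f : W) : W := fun m => f (l :: m).
Definition sg (f : W) : W := fun m => (-1) ^+ size m * f m.

(** The first letter of a word comes from f or from g; in the second case it has passed every letter
    taken from f, which is the sign in [sg f]. *)
Fixpoint shuf (f g : W) (m : mono) : K :=
  if m is l :: m' then shuf (der l f) g m' + shuf (sg f) (der l g) m'
  else f [::] * g [::].

Definition wone : W := fun m => (m == [::])%:R.

Lemma derD l f g : der l (f + g) = der l f + der l g. Proof. by []. Qed.
Lemma derZ l c f : der l (c *: f) = c *: der l f. Proof. by []. Qed.
Lemma der0 l : der l 0 = 0. Proof. by []. Qed.

Lemma sg_is_linear : linear sg.
Proof.
by move=> c f g; apply/funext => m; rewrite /sg !wfunDE !wscaleE mulrDr mulrCA.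
Qed.
HB.instance Definition _ := GRing.isLinear.Build K W W _ sg sg_is_linear.

Lemma der_is_linear l : linear (der l). Proof. by []. Qed.
HB.instance Definition _ l := GRing.isLinear.Build K W W _ (der l) (der_is_linear l).

Lemma der_sg l f : der l (sg f) = - sg (der l f).
Proof. by apply/funext => m; rewrite wfunNE /sg /der /= exprS mulN1r mulNr. Qed.

Lemma sgK f : sg (sg f) = f.
Proof.
by apply/funext => m; rewrite /sg mulrA -expr2 sqrr_sign mul1r.
Qed.

Lemma shufDl f f' g m : shuf (f + f') g m = shuf f g m + shuf f' g m.
Proof.
elim: m f f' g => [|l m IH] f f' g /=; first by rewrite wfunDE mulrDl.
by rewrite derD !linearD /= !IH addrACA.
Qed.

Lemma shufDr f g g' m : shuf f (g + g') m = shuf f g m + shuf f g' m.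
Proof.
elim: m f g g' => [|l m IH] f g g' /=; first by rewrite wfunDE mulrDr.
by rewrite derD !IH addrACA.
Qed.

Lemma shufZl c f g m : shuf (c *: f) g m = c * shuf f g m.
Proof.
elim: m f g => [|l m IH] f g /=; first by rewrite wscaleE mulrA.
by rewrite derZ !linearZ /= !IH mulrDr.
Qed.

Lemma shufZr c f g m : shuf f (c *: g) m = c * shuf f g m.
Proof.
elim: m f g => [|l m IH] f g /=; first by rewrite wscaleE mulrCA.
by rewrite derZ !IH mulrDr.
Qed.

Lemma der_shuf l f g : der l (shuf f g) = (shuf (der l f) g : W) + shuf (sg f) (der l g).
Proof. by []. Qed.

Lemma sg_shuf f g : sg (shuf f g) = shuf (sg f) (sg g).
Proof.
apply/funext => m; elim: m f g => [|l m IH] f g; first by rewrite /sg /= !mul1r.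
have <- : - sg (der l (shuf f g)) m = sg (shuf f g) (l :: m).
  by rewrite -wfunNE -der_sg.
rewrite der_shuf linearD /= wfunDE !IH !der_sg -!scaleN1r shufZl shufZr.
by rewrite !mulN1r opprD.
Qed.

(** Since [der l] is a superderivation and [sg] is multiplicative, both sides reduce at a word
    [l :: m] to the same three triple products at m. *)
Lemma shufA f g h : shuf f (shuf g h) = shuf (shuf f g) h.
Proof.
apply/funext => m; elim: m f g h => [|l m IH] f g h; first by rewrite /= mulrA.
rewrite /= !der_shuf sg_shuf shufDl shufDr !IH addrA; congr (_ + _ + _).
Qed.

Lemma shuf1l : left_id wone shuf.
Proof.
move=> f; apply/funext => m; elim: m f => [|l m IH] f; first by rewrite /= mul1r.
rewrite /=.
have -> : der l wone = 0 :> W by [].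
have -> : sg wone = wone.
  by apply/funext => -[|a u]; rewrite /sg /wone /= ?mul1r ?mulr0.
by rewrite IH -[0](scale0r (0 : W)) shufZl mul0r add0r.
Qed.

Lemma shuf1r : right_id wone shuf.
Proof.
move=> f; apply/funext => m; elim: m f => [|l m IH] f; first by rewrite /= mulr1.
rewrite /= IH.
have -> : der l wone = 0 :> W by [].
by rewrite -[0](scale0r (0 : W)) shufZr mul0r addr0.
Qed.

Lemma shuf_distl : left_distributive shuf +%R.
Proof. by move=> f g h; apply/funext => m; rewrite shufDl. Qed.
Lemma shuf_distr : right_distributive shuf +%R.
Proof. by move=> f g h; apply/funext => m; rewrite shufDr. Qed.
Lemma wone_neq0 : wone != 0 :> W.
Proof.
apply/eqP => /(congr1 (fun f : W => f [::])); rewrite /wone eqxx wfun0E => /eqP.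
by rewrite oner_eq0.
Qed.

HB.instance Definition _ := GRing.Zmodule_isNzRing.Build W
  shufA shuf1l shuf1r shuf_distl shuf_distr wone_neq0.

Lemma wmulE (f g : W) m : (f * g) m = shuf f g m. Proof. by []. Qed.
Lemma wone_E m : (1 : W) m = (m == [::])%:R. Proof. by []. Qed.

Lemma wscaleAl (a : K) (u v : W) : a *: (u * v) = (a *: u) * v.
Proof. by apply/funext => m; rewrite wmulE shufZl. Qed.
HB.instance Definition _ := GRing.Lmodule_isLalgebra.Build K W wscaleAl.

Lemma wscaleAr (a : K) (u v : W) : a *: (u * v) = u * (a *: v).
Proof. by apply/funext => m; rewrite wmulE shufZr. Qed.
HB.instance Definition _ := GRing.Lalgebra_isAlgebra.Build K W wscaleAr.

Lemma sg_multiplicative : monoid_morphism sg.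
Proof.
split; last exact: sg_shuf.
by apply/funext => -[|a u]; rewrite /sg wone_E /= ?mul1r ?mulr0.
Qed.
HB.instance Definition _ := GRing.isMonoidMorphism.Build W W sg sg_multiplicative.

Lemma derM l (f g : W) : der l (f * g) = der l f * g + sg f * der l g.
Proof. by []. Qed.
Lemma der1 l : der l 1 = 0. Proof. by []. Qed.
End ShuffleAlgebra.

(** * Bit masks and index bounds of words *)

Lemma bitseqsS n :
  bitseqs n.+1 = map (cons true) (bitseqs n) ++ map (cons false) (bitseqs n).
Proof. by rewrite /= cats0. Qed.

Lemma mem_bitseqs n s : (s \in bitseqs n) = (size s == n).
Proof.
elim: n s => [|n IH] s; first by rewrite inE; case: s.
rewrite bitseqsS mem_cat; case: s => [|b s].
  by apply/negbTE; rewrite negb_or; apply/andP; split; apply/mapP => -[].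
rewrite -[size _ == _]/(size s == n) -IH.
case: b; rewrite mem_map ?orbF; try by move=> ? ? [].
  by rewrite (_ : (_ \in map (cons false) _) = false) ?orbF //; apply/mapP => -[].
by rewrite (_ : (_ \in map (cons true) _) = false) //; apply/mapP => -[].
Qed.

Lemma size_bitseqs n : size (bitseqs n) = (2 ^ n)%N.
Proof.
by elim: n => // n IH; rewrite bitseqsS size_cat !size_map IH addnn expnS mul2n.
Qed.

Lemma uniq_bitseqs n : uniq (bitseqs n).
Proof.
elim: n => // n IH; rewrite bitseqsS cat_uniq !map_inj_uniq ?IH //=; try by move=> ? ? [].
by rewrite andbT; apply/hasPn => s /mapP[t _ ->]; apply/mapP => -[].
Qed.

Definition below (i : nat) (m : mono) := all (fun l : letter => (l.2 < i)%N) m.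

Lemma below_subseq i u m : subseq u m -> below i m -> below i u.
Proof. by move=> /mem_subseq s /allP b; apply/allP => l /s /b. Qed.

Lemma below_le i j m : (i <= j)%N -> below i m -> below j m.
Proof. by move=> ij; apply: sub_all => l /leq_trans; apply. Qed.

Lemma bnd_le m N : (bnd m <= N)%N = (0 < N)%N && below N m.
Proof.
case: N => // N; rewrite /bnd ltnS /=; elim: m => [|l m IH] //=.
by rewrite geq_max IH ltnS.
Qed.

Lemma below_bnd m : below (bnd m) m.
Proof. by have := leqnn (bnd m); rewrite bnd_le => /andP[]. Qed.

Lemma bnd_subseq u m : subseq u m -> (bnd u <= bnd m)%N.
Proof. by move=> s; rewrite bnd_le /= (below_subseq s) // below_bnd. Qed.

(** * Explicit form of the product, and alternating functions *)

Section Grassmann.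
Variable K : fieldType.
Local Notation W := (wfun K).

(** The sum used in [e_mul] satisfies the recursion of [shuf]: the first bit says which factor takes
    the first letter, and a first bit [false] adds one inversion for each letter given to f. *)
Lemma wmul_sum (f g : W) m : (f * g) m = \sum_(ms <- bitseqs (size m))
   (-1) ^+ shuffle_inv ms * f (mask ms m) * g (mask (map negb ms) m).
Proof.
elim: m f g => [|l m IH] f g; first by rewrite big_seq1 /= mul1r.
rewrite -[LHS]/((der l f * g) m + (sg f * der l g) m) !IH /size -/size.
rewrite bitseqsS big_cat !big_map; congr (_ + _).
apply: eq_big_seq => s; rewrite mem_bitseqs => /eqP ss /=.
by rewrite /sg /der exprD size_mask // !mulrA [_ ^+ count _ _ * _]mulrC.
Qed.

(** Locality of the product; it takes the place of a notion of convergence for infinite sums. *)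
Lemma wmul_local (f f' g g' : W) m :
  (forall u, subseq u m -> f u = f' u) -> (forall u, subseq u m -> g u = g' u) ->
  (f * g) m = (f' * g') m.
Proof.
move=> hf hg; rewrite !wmul_sum; apply: eq_bigr => ms _.
by rewrite hf ?hg ?mask_subseq.
Qed.

Lemma wmul_local0l (f g : W) m :
  (forall u, subseq u m -> f u = 0) -> (f * g) m = 0.
Proof.
by move=> hf; rewrite (@wmul_local f 0 g g) // mul0r.
Qed.
Lemma wmul_local0r (f g : W) m :
  (forall u, subseq u m -> g u = 0) -> (f * g) m = 0.
Proof.
by move=> hg; rewrite (@wmul_local f f g 0) // mulr0.
Qed.

Definition gen (l : letter) : W := fun m => (m == [:: l])%:R.

Lemma der_gen a l : der a (gen l) = (a == l)%:R.
Proof.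
apply/funext => m; rewrite /der /gen eqseq_cons; case: eqP => _ //=.
Qed.

Lemma sg_gen l : sg (gen l) = - gen l.
Proof.
apply/funext => m; rewrite wfunNE /sg /gen.
by case: eqP => [->|_]; rewrite ?mulr0 ?oppr0 //= mulr1.
Qed.

(** The antisymmetric extensions of coefficient functions from sorted words to all words; these
    represent the Grassmann elements. *)
Definition alt (f : W) :=
  forall u a b v, f (u ++ a :: b :: v) = - f (u ++ b :: a :: v).

Lemma alt_der l f : alt f -> alt (der l f).
Proof. by move=> af u a b v; apply: (af (l :: u)). Qed.

Lemma alt_sg f : alt f -> alt (sg f).
Proof. by move=> af u a b v; rewrite /sg af !size_cat mulrN. Qed.

Lemma alt_derC a b f : alt f -> der a (der b f) = - der b (der a f).
Proof. by move=> af; apply/funext => v; apply: (af [::]). Qed.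

(** At the front of a word the claim is that [der a] and [der b] anticommute on the product, which
    follows from the derivation rule; swaps further in are reached by peeling off first letters. *)
Lemma alt_mul (f g : W) : alt f -> alt g -> alt (f * g).
Proof.
move=> + + u; elim: u f g => [|l u IH] f g af ag a b v /=.
  rewrite -![(f * g) _]/(der _ (der _ (f * g)) v) !derM !linearD /= !derM !sgK.
  rewrite !(alt_derC b a) // !der_sg mulNr mulrN !mulNr.
  rewrite !wfunDE !wfunNE; ring.
have E w : (f * g) (l :: w) = (der l f * g) w + (sg f * der l g) w by [].
rewrite !E opprD; congr (_ + _); apply: IH => //; by [apply: alt_der|apply: alt_sg].
Qed.
End Grassmann.

(** * The Poisson bracket *)

Section Bracket.
Variable K : fieldType.
Hypothesis hK : (2%:R : K) != 0.
Local Notation W := (wfun K).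

Lemma eq_oppr0 (x : K) : x = - x -> x = 0.
Proof.
move=> h; apply/eqP; have: x *+ 2 == 0 by rewrite mulr2n {1}h addNr.
by rewrite -mulr_natr mulf_eq0 (negbTE hK) orbF.
Qed.

Lemma wfun_eq_oppr0 (f : W) : f = - f -> f = 0.
Proof. by move=> h; apply/funext => m; apply: eq_oppr0; rewrite -wfunNE -h. Qed.

(** Homogeneity of parity p ([true] for odd), stated as an eigenvector condition for the sign
    automorphism. *)
Definition par (p : bool) (f : W) := sg f = (-1) ^+ p *: f.

Lemma par_gen l : par true (gen K l).
Proof. by rewrite /par sg_gen expr1 scaleN1r. Qed.
Lemma par1 : par false 1.
Proof. by rewrite /par rmorph1 expr0 scale1r. Qed.
Lemma par_mul p r (f g : W) : par p f -> par r g -> par (p (+) r) (f * g).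
Proof.
rewrite /par => hf hg; rewrite rmorphM /= hf hg -scalerAl -scalerAr scalerA.
by rewrite signr_addb.
Qed.
Lemma par_der p l f : par p f -> par (~~ p) (der l f).
Proof.
rewrite /par => hf; rewrite -[LHS]opprK -der_sg hf derZ -scaleN1r scalerA.
by congr (_ *: _); case: p {hf}; rewrite /= ?expr0 ?expr1; ring.
Qed.

(** Shuffling is symmetric up to sign. Peeling off a letter flips the parity of the factor it is
    taken from; the characteristic enters only at the empty word, where an odd function has to
    vanish. *)
Lemma supercomm p r (f g : W) : par p f -> par r g ->
  f * g = (-1) ^+ (p && r) *: (g * f).
Proof.
move=> hf hg; apply/funext => m; elim: m p r f g hf hg => [|l m IH] p r f g hf hg.
  have E (h h' : W) : (h * h') [::] = h [::] * h' [::] by [].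
  rewrite wscaleE !E.
  case: p hf => [|_]; last by rewrite mul1r mulrC.
  rewrite /par expr1 scaleN1r => /(congr1 (fun h : W => h [::])).
  rewrite wfunNE /sg /= mul1r => /eq_oppr0 ->.
  by rewrite mul0r !mulr0.
have E (h h' : W) : (h * h') (l :: m) = (der l h * h') m + (sg h * der l h') m by [].
rewrite wscaleE !E.
rewrite (IH _ _ _ _ (par_der l hf) hg).
rewrite hf hg -!scalerAl !wscaleE (IH _ _ _ _ hf (par_der l hg)) !wscaleE.
by case: p {hf}; case: r {hg}; rewrite /= ?expr0 ?expr1; ring.
Qed.

Lemma odd_anticomm (f g : W) : par true f -> par true g -> f * g = - (g * f).
Proof. by move=> hf hg; rewrite (supercomm hf hg) expr1 scaleN1r. Qed.
Lemma odd_sqr (f : W) : par true f -> f * f = 0.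
Proof. by move=> hf; apply: wfun_eq_oppr0; apply: odd_anticomm. Qed.

(** The Poisson bracket with its index sum cut off at N. As [der] flips parity, [sg (der l f)]
    contains the sign [(-1)^(|f|-1)]. *)
Definition brN (N : nat) (f g : W) : W := \sum_(i <- iota 0 N)
  (sg (der (false, i) f) * der (true, i) g + sg (der (true, i) f) * der (false, i) g).

Lemma brN_Dl N f f' g : brN N (f + f') g = brN N f g + brN N f' g.
Proof.
rewrite /brN -big_split; apply: eq_bigr => i _ /=.
by rewrite !linearD /= !mulrDl addrACA.
Qed.
Lemma brN_Dr N f g g' : brN N f (g + g') = brN N f g + brN N f g'.
Proof.
rewrite /brN -big_split; apply: eq_bigr => i _ /=.
by rewrite !linearD /= !mulrDr addrACA.
Qed.
Lemma brN_Zl N c f g : brN N (c *: f) g = c *: brN N f g.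
Proof.
rewrite /brN scaler_sumr; apply: eq_bigr => i _ /=.
by rewrite !linearZ /= -!scalerAl scalerDr.
Qed.
Lemma brN_Zr N c f g : brN N f (c *: g) = c *: brN N f g.
Proof.
rewrite /brN scaler_sumr; apply: eq_bigr => i _ /=.
by rewrite !linearZ /= -!scalerAr scalerDr.
Qed.

Lemma brN_sym N p r f g : par p f -> par r g ->
  brN N f g = - ((-1) ^+ (p && r) *: brN N g f).
Proof.
move=> hf hg; rewrite /brN scaler_sumr -sumrN; apply: eq_bigr => i _ /=.
rewrite !(par_der _ hf) !(par_der _ hg) -!scalerAl.
rewrite 2?[der _ f * _](supercomm (par_der _ hf) (par_der _ hg)).
rewrite !scalerDr !scalerA opprD addrC; congr (_ + _); rewrite -scaleNr;
  by congr (_ *: _); case: p {hf}; case: r {hg}; rewrite /= ?expr0 ?expr1; ring.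
Qed.

Lemma brN_Mr N p r (a b c : W) : par p a -> par r b ->
  brN N a (b * c) = brN N a b * c + (-1) ^+ (p && r) *: (b * brN N a c).
Proof.
move=> ha hb; rewrite /brN mulr_suml mulr_sumr scaler_sumr -big_split.
apply: eq_bigr => i _ /=.
rewrite !derM !mulrDr mulrDl !mulrA addrACA; congr (_ + _).
rewrite scalerDr !(par_der _ ha) hb -!scalerAl -?scalerAr ?mulrA -?scalerAl.
rewrite !(supercomm (par_der _ ha) hb) -!scalerAl !scalerA.
by congr (_ *: _ + _ *: _); case: p {ha}; case: r {hb}; rewrite /= ?expr0 ?expr1; ring.
Qed.

Lemma brN_Ml N p r (a b c : W) : par p b -> par r c ->
  brN N (a * b) c = a * brN N b c + (-1) ^+ (p && r) *: (brN N a c * b).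
Proof.
move=> hb hc; rewrite /brN mulr_suml mulr_sumr scaler_sumr -big_split.
apply: eq_bigr => i _ /=.
rewrite !derM !linearD /= !rmorphM /= !sgK !mulrDl !mulrDr !mulrA [LHS]addrACA.
rewrite [LHS]addrC; congr (_ + _); rewrite hb -!scalerAr -!scalerAl scalerDr.
rewrite -!mulrA !(supercomm hb (par_der _ hc)) -!scalerAr !scalerA.
by congr (_ *: _ + _ *: _); case: p {hb}; case: r {hc}; rewrite /= ?expr0 ?expr1; ring.
Qed.

(** A weak form of the support condition of the completion, stable under products, which suffices to
    make the bracket sum finite at each word. *)
Definition tame (f : W) := forall i m, below i m -> f ((false, i) :: m) = 0.

Lemma tame1 : tame 1. Proof. by []. Qed.

Lemma tame_mul (f g : W) : tame f -> tame g -> tame (f * g).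
Proof.
move=> tf tg i m bm; rewrite -[LHS]/(der (false, i) (f * g) m) derM wfunDE.
rewrite wmul_local0l ?wmul_local0r ?addr0 // => u um.
  by rewrite /der tg // (below_subseq um).
by rewrite /der tf // (below_subseq um).
Qed.

Definition br (f g : W) : W := fun m => brN (bnd m) f g m.

(** Each term of index i has a factor derived by x_i, and for i at least [bnd m] tameness makes this
    factor vanish on all subwords of m. *)
Lemma brNE f g m N : tame f -> tame g -> (bnd m <= N)%N -> brN N f g m = br f g m.
Proof.
move=> tf tg; move=> /subnKC <-; move: (N - _)%N => k.
rewrite /br /brN iotaD big_cat /= add0n wfunDE [X in _ + X = _](_ : _ = 0) ?addr0 //.
rewrite wfun_sumE big_seq big1 // => i; rewrite mem_iota => /andP[bi _].
have bm : below i m by move: bi; rewrite bnd_le => /andP[].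
rewrite wfunDE wmul_local0l ?wmul_local0r ?addr0 // => u um.
  by rewrite /der tg // (below_subseq um).
by rewrite /sg /der tf ?mulr0 // (below_subseq um).
Qed.

(** The way brackets are computed below: a value of [brN] common to all large N is the value of
    [br]. *)
Lemma br_eq_brN f g h N0 : tame f -> tame g ->
  (forall N, (N0 <= N)%N -> brN N f g = h) -> br f g = h.
Proof.
move=> tf tg H; apply/funext => m.
by rewrite -(@brNE _ _ _ (maxn (bnd m) N0)) ?leq_maxl // H // leq_maxr.
Qed.

Lemma br_Dl f f' g : br (f + f') g = br f g + br f' g.
Proof. by apply/funext => m; rewrite wfunDE /br brN_Dl. Qed.
Lemma br_Dr f g g' : br f (g + g') = br f g + br f g'.
Proof. by apply/funext => m; rewrite wfunDE /br brN_Dr. Qed.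
Lemma br_Zl c f g : br (c *: f) g = c *: br f g.
Proof. by apply/funext => m; rewrite wscaleE /br brN_Zl. Qed.
Lemma br_Zr c f g : br f (c *: g) = c *: br f g.
Proof. by apply/funext => m; rewrite wscaleE /br brN_Zr. Qed.

Lemma br_sym p r f g : par p f -> par r g -> br f g = - ((-1) ^+ (p && r) *: br g f).
Proof. by move=> hf hg; apply/funext => m; rewrite /br (brN_sym _ hf hg). Qed.

(** At a fixed word this is the truncated Leibniz rule; on a subword u the bound [bnd u] may be
    replaced by [bnd m]. *)
Lemma br_Mr p r (a b c : W) : par p a -> par r b -> tame a -> tame b -> tame c ->
  br a (b * c) = br a b * c + (-1) ^+ (p && r) *: (b * br a c).
Proof.
move=> ha hb ta tb tc; apply/funext => m; rewrite {1}/br (brN_Mr _ _ ha hb).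
rewrite !wfunDE !wscaleE; congr (_ + _ * _); apply: wmul_local => // u um;
  by rewrite brNE // bnd_subseq.
Qed.

Lemma br_Ml p r (a b c : W) : par p b -> par r c -> tame a -> tame b -> tame c ->
  br (a * b) c = a * br b c + (-1) ^+ (p && r) *: (br a c * b).
Proof.
move=> hb hc ta tb tc; apply/funext => m; rewrite {1}/br (brN_Ml _ _ hb hc).
rewrite !wfunDE !wscaleE; congr (_ + _ * _); apply: wmul_local => // u um;
  by rewrite brNE // bnd_subseq.
Qed.
End Bracket.

(** * The pivot elements *)

Lemma lt_letter_trans : transitive lt_letter.
Proof.
move=> [b j] [a i] [c k]; rewrite /lt_letter /=.
by case: a; case: b; case: c => //=; apply: ltn_trans.
Qed.
Lemma lt_letter_irr l : lt_letter l l = false.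
Proof. by case: l => [[] i]; rewrite /lt_letter /= ltnn. Qed.
Lemma lt_letter_total a b : ~~ lt_letter a b -> a != b -> lt_letter b a.
Proof.
move: a b => [a i] [b j]; rewrite /lt_letter xpair_eqE /=.
by case: a; case: b => //=; rewrite -leqNgt leq_eqVlt eq_sym => /orP[/eqP->|//]; rewrite eqxx.
Qed.
Lemma canon_cons l m : canon (l :: m) = all (lt_letter l) m && canon m.
Proof. by rewrite /canon /= (path_sortedE lt_letter_trans). Qed.
Lemma canon_subseq u m : subseq u m -> canon m -> canon u.
Proof. by move=> s; apply: subseq_sorted s; apply: lt_letter_trans. Qed.

Lemma mem_ins l m a : (a \in ins l m) = (a \in l :: m).
Proof.
elim: m => //= b m IH; case: ifP => _ //.
by rewrite inE IH !inE orbCA.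
Qed.

Lemma canon_ins l m : canon m -> l \notin m -> canon (ins l m).
Proof.
elim: m => [|b m IH]; first by [].
rewrite [ins _ _]/= canon_cons inE negb_or => /andP[bm cm] /andP[lb lm].
case: ifP => [bl|/negbT bl]; rewrite canon_cons; last first.
  have lb' : lt_letter l b by apply: lt_letter_total; rewrite // eq_sym.
  rewrite canon_cons bm cm /= lb' !andbT; apply/allP => a /(allP bm).
  exact: lt_letter_trans.
rewrite IH // andbT; apply/allP => a; rewrite mem_ins inE => /orP[/eqP->//|].
exact: (allP bm).
Qed.

Lemma vwordS i k :
  vword i k.+1 = (false, i) :: (false, i.+1) :: vword (i + 3) k.
Proof.
rewrite /vword /= muln0 !addn0 addn1; congr (_ :: _ :: _ ++ [:: (_, _)]); last lia.
rewrite (iotaDl 1 0 k) -map_comp; congr flatten; apply: eq_map => n /=.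
by congr [:: (_, _); (_, _)]; lia.
Qed.

Lemma size_vword i k : size (vword i k) = k.*2.+1.
Proof. by elim: k i => // k IH i; rewrite vwordS /= IH. Qed.

Lemma vword_ge i k a : a \in vword i k -> (i <= a.2)%N.
Proof.
elim: k i => [|k IH] i; first by rewrite /vword inE => /eqP ->; rewrite leq_addr.
by rewrite vwordS !inE => /or3P[/eqP->|/eqP->|/IH] //=; lia.
Qed.

Lemma vword_canon i k : canon (vword i k).
Proof.
elim: k i => // k IH i; rewrite vwordS !canon_cons IH andbT.
have H a : a \in vword (i + 3) k -> (i.+1 < a.2)%N by move/vword_ge; lia.
have L (j : nat) (a : letter) : (j < a.2)%N -> lt_letter (false, j) a.
  by case: a => -[] n //= jn; rewrite /lt_letter /= jn.
apply/andP; split.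
  by rewrite /= L //=; apply/allP => a /H ai; exact: L (ltnW ai).
by apply/allP => a /H; apply: L.
Qed.

Section Pivots.
Variable K : fieldType.
Local Notation W := (wfun K).
Local Notation x i := (gen K (false, i)).
Local Notation y i := (gen K (true, i)).

(** The k-th monomial of V_i. *)
Fixpoint vprod (i k : nat) : W :=
  if k is k'.+1 then x i * (x i.+1 * vprod (i + 3) k') else y i.
(** The k-th monomial has length 2k+1, so the length of a word singles out the only summand of V_i
    that can be nonzero there. *)
Definition Vw (i : nat) : W := fun m => vprod i (size m)./2 m.

Lemma gen_mul_local l (g g' : W) m :
  (forall u, (size u).+1 = size m -> g u = g' u) -> (gen K l * g) m = (gen K l * g') m.
Proof.
move=> H; rewrite !wmul_sum; apply: eq_big_seq => ms; rewrite mem_bitseqs => /eqP sm.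
rewrite /gen; case: eqP => [e|_]; last by rewrite mulr0 !mul0r.
rewrite H // size_mask ?size_map // -sm -(count_predC id ms) count_map.
by rewrite -(size_mask sm) e.
Qed.

Lemma gen_mul_nil l (g : W) : (gen K l * g) [::] = 0.
Proof. by rewrite -[LHS]/(0 * _) mul0r. Qed.

(** Self-similarity of the pivots, the source of all their bracket relations. At a given word, its
    length leaves at most one of the two summands nonzero. *)
Lemma Vw_rec i : Vw i = y i + x i * (x i.+1 * Vw (i + 3)).
Proof.
apply/funext => m; rewrite wfunDE /Vw; case E: (size m)./2 => [|k].
  rewrite [X in _ = _ + X](_ : _ = 0) ?addr0 //.
  rewrite (@gen_mul_local _ _ 0) ?mulr0 // => u su.
  have -> : u = [::] by case: u su => // a u; case: m E => [|? [|]].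
  exact: gen_mul_nil.
rewrite /= [X in _ = X + _](_ : _ = 0) ?add0r; last first.
  by rewrite /gen; case: m E => [|? [|? ?]] //= _; rewrite eqseq_cons andbF.
apply: gen_mul_local => u su; apply: gen_mul_local => v sv.
by have -> : (size v)./2 = k by move: E; rewrite -su -sv => -[].
Qed.

Lemma par_vprod i k : par true (vprod i k).
Proof.
elim: k i => [|k IH] i; first exact: par_gen.
exact: (par_mul (par_gen _ _) (par_mul (par_gen _ _) (IH _))).
Qed.

Lemma par_Vw i : par true (Vw i).
Proof.
apply/funext => m; rewrite wscaleE /Vw.
by have /(congr1 (fun f : W => f m)) := par_vprod i (size m)./2.
Qed.

Lemma der_vprod l i k : (l.2 < i)%N -> der l (vprod i k) = 0.
Proof.
elim: k i => [|k IH] i li.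
  by rewrite /= der_gen; case: eqP => // e; move: li; rewrite e /= ltnn.
rewrite /= !derM !der_gen IH ?mulr0 ?addr0; last by lia.
case: eqP => [e|_]; first by move: li; rewrite e /= ltnn.
case: eqP => [e|_]; first by move: li; rewrite e /=; lia.
by rewrite !mul0r mulr0 addr0.
Qed.

Lemma der_Vw l i : (l.2 < i)%N -> der l (Vw i) = 0.
Proof.
move=> li; apply/funext => m.
by rewrite /der /Vw -[LHS]/(der l (vprod i (size (l :: m))./2) m) der_vprod.
Qed.

Lemma alt_gen l : alt (gen K l).
Proof.
by move=> [|c u] a b v; rewrite /gen /= !eqseq_cons /= ?andbF ?oppr0 //;
  case: u => [|? ?] /=; rewrite andbF oppr0.
Qed.

Lemma alt_vprod i k : alt (vprod i k).
Proof.
elim: k i => [|k IH] i; first exact: alt_gen.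
by apply: alt_mul; [apply: alt_gen|apply: alt_mul; [apply: alt_gen|apply: IH]].
Qed.

Lemma alt_Vw i : alt (Vw i).
Proof. by move=> u a b v; rewrite /Vw alt_vprod !size_cat. Qed.

Definition high (k : nat) (f : W) := forall m, below k m -> f m = 0.

Lemma high_le j k f : (j <= k)%N -> high k f -> high j f.
Proof. by move=> jk h m /(below_le jk); apply: h. Qed.

Lemma high_mulr k (f g : W) : high k g -> high k (f * g).
Proof.
by move=> h m bm; apply: wmul_local0r => u um; apply: h; apply: below_subseq um bm.
Qed.

(** Deriving by x_i itself leaves h, which vanishes on words below i; the other contributions derive
    h, which is tame. *)
Lemma tame_gen_mul i (h : W) : high i h -> tame h -> tame (x i * h).
Proof.
move=> hh th j m bm; rewrite -[LHS]/(der (false, j) (x i * h) m) derM wfunDE.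
rewrite der_gen [X in _ + X]wmul_local0r ?addr0; last first.
  by move=> u um; rewrite /der th //; apply: below_subseq um bm.
by case: eqP => [[e]|_]; rewrite ?mul0r // mul1r hh // -e.
Qed.

Lemma high_vprod i k : high i (vprod i k).
Proof.
elim: k i => [|k IH] i.
  move=> m bm; rewrite /= /gen; case: eqP => // e.
  by move: bm; rewrite e /= ltnn.
by do 2!apply: high_mulr; apply: high_le (IH _); lia.
Qed.

Lemma tame_vprod i k : tame (vprod i k).
Proof.
elim: k i => [|k IH] i; first by move=> j m _; rewrite /= /gen eqseq_cons.
have h := @high_vprod (i + 3) k.
apply: tame_gen_mul; first by apply: high_mulr; apply: high_le h; lia.
by apply: tame_gen_mul => //; apply: high_le h; lia.
Qed.

Lemma high_Vw i : high i (Vw i).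
Proof. by move=> m; apply: high_vprod. Qed.
Lemma tame_Vw i : tame (Vw i).
Proof. by move=> j m; apply: tame_vprod. Qed.

(** The passage from word functions back to the coefficient functions of the statement, which are
    meaningful on sorted words only. *)
Definition restr (f : W) : elt K := fun m => if canon m then f m else 0.

(** All letters of g have index above i, so x_i precedes them in a sorted word and can only be its
    first letter. *)
Lemma gen_mul_canon i (g : W) l m : canon (l :: m) ->
  (forall a : letter, (a.2 <= i)%N -> der a g = 0) ->
  (x i * g) (l :: m) = (l == (false, i))%:R * g m.
Proof.
rewrite canon_cons => /andP[/allP lm cm] hg.
rewrite -[LHS]/(der l (x i * g) m) derM wfunDE der_gen.
case: eqP => [e|ne]; first by rewrite hg ?e // mulr0 addr0 mul1r mulr1n mul1r.
rewrite !mul0r add0r; case: (leqP l.2 i) => li; first by rewrite hg ?mulr0.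
apply: wmul_local0l => u um; rewrite /sg /gen; case: eqP => [e|]; last by rewrite mulr0.
have /lm : (false, i) \in m by rewrite -sub1seq -e.
by rewrite /lt_letter /= ltnNge (ltnW li) andbF /= andbF.
Qed.

Lemma vprod_canon i k m : canon m -> vprod i k m = (m == vword i k)%:R.
Proof.
elim: k i m => [|k IH] i m cm.
  by rewrite /= /gen /vword /= muln0 addn0.
rewrite vwordS /=; case: m cm => [|l m] cm; first by rewrite gen_mul_nil.
have cm' : canon m by move: cm; rewrite canon_cons => /andP[].
rewrite gen_mul_canon //; last first.
  move=> a ai; rewrite derM der_gen der_vprod; last by lia.
  rewrite mulr0 addr0; case: eqP => [e|_]; last by rewrite mul0r.
  by move: ai; rewrite e /= ltnn.
rewrite eqseq_cons; case: eqP => _; last by rewrite mul0r.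
rewrite mul1r; case: m cm' {cm} => [|a m] cm; first by rewrite gen_mul_nil.
rewrite gen_mul_canon //; last by move=> b bi; rewrite der_vprod //; lia.
rewrite eqseq_cons; case: eqP => _; last by rewrite mul0r.
by rewrite mul1r IH //; move: cm; rewrite canon_cons => /andP[].
Qed.

Lemma V_restr i : V K i = restr (Vw i).
Proof.
apply/funext => m; rewrite /V /restr; case: ifP => [cm|/negbT cm].
  rewrite /Vw vprod_canon //; congr (_%:R); congr nat_of_bool.
  apply/hasP/eqP => [[k _ /eqP e]|e].
    by rewrite e size_vword /= uphalf_double.
  exists (size m)./2; last exact/eqP.
  rewrite mem_iota add0n ltnS /= -[X in (_ <= X)%N]odd_double_half; lia.
rewrite (_ : has _ _ = false) //; apply/hasP => -[k _ /eqP e].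
by rewrite e vword_canon in cm.
Qed.

End Pivots.

(** * Comparison of the shuffle algebra with the operations on sorted words *)

Section Restriction.
Variable K : fieldType.
Hypothesis hK : (2%:R : K) != 0.
Local Notation W := (wfun K).

Lemma alt_mem0 (f : W) l m : alt f -> l \in m -> f (l :: m) = 0.
Proof.
elim: m f => // a m IH f af; rewrite inE => /predU1P[<-|lm].
  by apply: (eq_oppr0 hK); apply: (af [::]).
by rewrite (af [::]) /= -[f _]/(der a f (l :: m)) IH ?oppr0 //; apply: alt_der.
Qed.

(** The sign is that of moving l from the front to its sorted place, past [pos l m] letters. *)
Lemma alt_ins (f : W) l m : alt f -> canon m -> l \notin m ->
  (-1) ^+ pos l m * f (ins l m) = f (l :: m).
Proof.
elim: m f => [|a m IH] f af; first by rewrite mul1r.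
rewrite canon_cons inE negb_or => /andP[am cm] /andP[la lm].
rewrite [ins _ _]/= /pos [count _ _]/= -/(pos l m).
case: ifP => [al|/negbT al].
  rewrite exprS -mulrA -[f _]/(der a f (ins l m)) IH //; last exact: alt_der.
  by rewrite mulN1r /der [RHS](af [::]).
have la' : lt_letter l a by apply: lt_letter_total; rewrite // eq_sym.
rewrite (_ : pos l m = 0%N) ?mul1r //; apply/eqP.
rewrite -leqn0 leqNgt -has_count; apply/hasPn => b /(allP am) ab.
by apply/negP => /(lt_letter_trans ab) /(lt_letter_trans la'); rewrite lt_letter_irr.
Qed.

(** By induction on the word it suffices to treat [l :: u] with u sorted: either l repeats and the
    value vanishes, or l moves to its sorted place up to sign. *)
Lemma alt_canon0 (f : W) : alt f -> (forall m, canon m -> f m = 0) -> f = 0.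
Proof.
move=> af h; apply/funext => m; elim: m f af h => [|l m IH] f af h; first exact: h.
rewrite -[LHS]/(der l f m) IH //; first exact: alt_der.
move=> u cu; rewrite /der; case: (boolP (l \in u)) => lu; first exact: alt_mem0.
by rewrite -alt_ins // h ?mulr0 // canon_ins.
Qed.

Lemma restrD (f g : W) : e_add (restr f) (restr g) = restr (f + g).
Proof. by apply/funext => m; rewrite /e_add /restr; case: ifP; rewrite ?addr0. Qed.

Lemma restr_sg (f : W) : e_sigma (restr f) = restr (sg f).
Proof. by apply/funext => m; rewrite /e_sigma /restr; case: ifP; rewrite ?mulr0. Qed.

Lemma restr1 : e_one K = restr 1.
Proof. by apply/funext => -[|a m]; rewrite /e_one /restr //=; case: ifP. Qed.

Lemma restr0 : e_zero K = restr 0.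
Proof. by apply/funext => m; rewrite /restr; case: ifP. Qed.

Lemma restrM (f g : W) : e_mul (restr f) (restr g) = restr (f * g).
Proof.
apply/funext => m; rewrite /e_mul [in RHS]/restr; case: ifP => // cm.
rewrite wmul_sum; apply: eq_bigr => ms _.
by rewrite /restr !(canon_subseq (mask_subseq _ _) cm).
Qed.

Lemma dterm_restr (f g : W) l1 l2 m1 m2 : alt f -> alt g -> canon m1 -> canon m2 ->
  dterm (restr f) (restr g) l1 l2 m1 m2 = der l1 f m1 * der l2 g m2.
Proof.
move=> af ag c1 c2; rewrite /dterm /der.
case: (boolP (l1 \in m1)) => h1 /=; first by rewrite alt_mem0 ?mul0r.
case: (boolP (l2 \in m2)) => h2 /=; first by rewrite [g _]alt_mem0 ?mulr0.
rewrite /restr !canon_ins // -(alt_ins af c1) // -(alt_ins ag c2) // exprD; ring.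
Qed.

Lemma restr_br (f g : W) : alt f -> alt g ->
  e_br (restr f) (restr g) = restr (br f g).
Proof.
move=> af ag; apply/funext => m; rewrite /e_br [in RHS]/restr; case: ifP => // cm.
rewrite /br /brN wfun_sumE exchange_big; apply: eq_bigr => i _ /=.
rewrite wfunDE !wmul_sum -big_split; apply: eq_bigr => ms _ /=.
rewrite !dterm_restr ?(canon_subseq (mask_subseq _ _) cm) // /sg; ring.
Qed.

Definition wkmul (p q : W * W) : W * W :=
  (p.1 * q.1 + br p.2 (sg q.2), p.2 * sg q.1 + p.1 * q.2).

Fixpoint wjeval (w : jword) : W * W :=
  match w with
  | JGen i => if (i < 3)%N then (Vw K i, 0) else (0, 1)
  | JMul u v => wkmul (wjeval u) (wjeval v)
  end.

(** Only barred components enter a bracket, so only these have to be alternating; [alt_wjeval]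
    establishes this later. *)
Lemma jeval_restr w : (forall u, alt (wjeval u).2) ->
  jeval K w = (restr (wjeval w).1, restr (wjeval w).2).
Proof.
move=> h; elim: w => [i|u IHu v IHv] /=.
  by case: ifP => _; rewrite -?V_restr -?restr1 -?restr0.
rewrite IHu IHv /kmul /= !restr_sg restr_br ?restrM ?restrD //.
by apply: alt_sg.
Qed.
End Restriction.

(** * Brackets of pivot elements *)

Section Commutation.
Variable K : fieldType.
Local Notation W := (wfun K).
Local Notation x i := (gen K (false, i)).
Local Notation y i := (gen K (true, i)).
Local Notation v i := (Vw K i).

Lemma sum_iota_eq N k (F : nat -> W) : (k < N)%N ->
  \sum_(i <- iota 0 N) ((i == k)%:R * F i) = F k.
Proof.
move=> kN; rewrite (bigD1_seq k) ?mem_iota ?iota_uniq //= eqxx mul1r big1 ?addr0 //.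
by move=> i /negbTE ->; rewrite mul0r.
Qed.

Lemma brN_y N k (g : W) : (k < N)%N -> brN N (y k) g = der (false, k) g.
Proof.
move=> kN; rewrite -[RHS](@sum_iota_eq N k (fun i => der (false, i) g)) //.
apply: eq_bigr => i _; rewrite !der_gen !xpair_eqE /= linear0 mul0r add0r.
by case: (i == k) => /=; rewrite ?rmorph1 ?linear0.
Qed.

Lemma brN_xM N k (b c : W) : (k < N)%N ->
  brN N (x k * b) c = x k * brN N b c + sg b * der (true, k) c.
Proof.
move=> kN; rewrite -[X in _ = _ + X](@sum_iota_eq N k (fun i => sg b * der (true, i) c)) //.
rewrite /brN mulr_sumr -big_split; apply: eq_bigr => i _ /=.
rewrite !derM !der_gen !xpair_eqE /= sg_gen !mulNr mul0r add0r.
rewrite !linearD !linearN /= !rmorphM /= sg_gen !mulNr !opprK mulrDl mulrDr !mulrA.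
by rewrite rmorph_nat -!addrA [LHS]addrC addrA.
Qed.

Lemma sg_odd (f : W) : par true f -> sg f = - f.
Proof. by move->; rewrite expr1 scaleN1r. Qed.

Lemma sg_v k : sg (v k) = - v k. Proof. exact: sg_odd (par_Vw _ _). Qed.

(** The Leibniz rule applied to [Vw_rec]. In the cases of interest the last, recursive term either
    vanishes or is the same problem at k + 3. *)
Lemma brN_v N k (g : W) : (k.+1 < N)%N ->
  brN N (v k) g = der (false, k) g + x k.+1 * (v (k + 3) * der (true, k) g)
     - x k * (v (k + 3) * der (true, k.+1) g)
     + x k * (x k.+1 * brN N (v (k + 3)) g).
Proof.
move=> kN; rewrite [v k]Vw_rec brN_Dl brN_y ?(ltnW kN) // brN_xM ?(ltnW kN) // brN_xM //.
rewrite rmorphM /= sg_gen sg_v mulrNN mulrDr mulNr mulrN -!mulrA.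
by rewrite -!addrA; congr (_ + _); rewrite addrC -addrA addrCA.
Qed.

Lemma der_v_x k : der (false, k) (v k) = x k.+1 * v (k + 3).
Proof.
rewrite Vw_rec derD derM derM !der_gen !xpair_eqE /= eqxx mul1r der_Vw /=; last by lia.
have -> : (k == k.+1) = false by lia.
by rewrite !(mul0r, mulr0, addr0, add0r).
Qed.

Lemma der_v_y k : der (true, k) (v k) = 1.
Proof.
rewrite Vw_rec derD derM derM !der_gen !xpair_eqE /= eqxx der_Vw /=; last by lia.
by rewrite !(mul0r, mulr0, addr0, add0r).
Qed.

Lemma der_v_y1 k : der (true, k.+1) (v k) = 0.
Proof.
rewrite Vw_rec derD derM derM !der_gen !xpair_eqE /= der_Vw /=; last by lia.
have -> : (k.+1 == k) = false by lia.
by rewrite !(mul0r, mulr0, addr0, add0r).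
Qed.

Lemma brN_vv_far N k l : (k.+1 < N)%N -> (k.+1 < l)%N ->
  brN N (v k) (v l) = x k * (x k.+1 * brN N (v (k + 3)) (v l)).
Proof.
move=> kN kl; rewrite brN_v // !der_Vw //=; try by lia.
by rewrite !mulr0 subr0 addr0 add0r.
Qed.

Lemma brN_vx_lt N k j : (j < k)%N -> brN N (v k) (x j) = 0.
Proof.
move=> jk; rewrite /brN big1 // => i _; rewrite !der_gen !xpair_eqE /= mulr0 add0r.
by case: eqP => [->|_]; rewrite ?mulr0 // der_Vw // linear0 mul0r.
Qed.

Lemma brN_vx N k j : (k.+1 < N)%N ->
  brN N (v k) (x j) = (k == j)%:R + x k * (x k.+1 * brN N (v (k + 3)) (x j)).
Proof.
move=> kN; rewrite brN_v // !der_gen !xpair_eqE /=.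
by rewrite !mulr0 subr0 addr0.
Qed.

Hypothesis hK : (2%:R : K) != 0.

Lemma brN_vv_sym N k l : brN N (v k) (v l) = brN N (v l) (v k).
Proof.
by rewrite (brN_sym hK _ (par_Vw _ _) (par_Vw _ _)) expr1 scaleN1r opprK.
Qed.

Lemma xx0 k (f : W) : x k * (x k * f) = 0.
Proof. by rewrite mulrA (odd_sqr hK (par_gen _ _)) mul0r. Qed.

Lemma xxC k l (f : W) : x k * (x l * f) = - (x l * (x k * f)).
Proof.
by rewrite !mulrA (odd_anticomm hK (par_gen _ _) (par_gen _ _)) mulNr.
Qed.

(** Contracting y_k with x_k and x_k with y_k gives equal terms, hence the factor 2; the recursive
    term contains x_k twice. *)
Lemma brN_vv0 N k : (k.+1 < N)%N ->
  brN N (v k) (v k) = 2%:R *: (x k.+1 * v (k + 3)).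
Proof.
move=> kN; rewrite brN_v // der_v_x der_v_y der_v_y1 !mulr0 subr0 mulr1.
rewrite brN_vv_sym brN_vv_far //; last by lia.
by rewrite [x k.+1 * (x k * _)]xxC mulrN xx0 !(mulr0, oppr0, addr0) scaler_nat mulr2n.
Qed.

(** The only surviving contraction is x_{k+1} in V_k with y_{k+1}; the recursive term contains
    x_{k+1} twice. *)
Lemma brN_vv1 N k : (k.+2 < N)%N ->
  brN N (v k) (v k.+1) = - (x k * v (k + 3)).
Proof.
move=> kN; rewrite brN_v ?(ltnW kN) // der_v_y !der_Vw //=.
rewrite !mulr0 !add0r mulr1 brN_vv_sym brN_vv_far ?xx0 ?mulr0 ?addr0 //; lia.
Qed.

Lemma brN_vv2 N k : (k.+4 < N)%N ->
  brN N (v k) (v k.+2) = - (x k * (x k.+1 * (x k.+2 * v (k + 5)))).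
Proof.
move=> kN; rewrite brN_vv_far //; last by lia.
rewrite brN_vv_sym addn3 brN_vv1 // !mulrN.
by rewrite (_ : (k.+2 + 3 = k + 5)%N) //; lia.
Qed.

Definition xs (a : seq nat) : W := \prod_(i <- a) x i.

Lemma xs_nil : xs [::] = 1. Proof. exact: big_nil. Qed.
Lemma xs_cons i a : xs (i :: a) = x i * xs a. Proof. exact: big_cons. Qed.
Lemma xs_cat a b : xs (a ++ b) = xs a * xs b. Proof. exact: big_cat. Qed.

Lemma par_xs a : par (odd (size a)) (xs a).
Proof.
elim: a => [|i a IH]; first by rewrite xs_nil; apply: par1.
by rewrite xs_cons; apply: (par_mul (par_gen _ _) IH).
Qed.

Lemma x_xs0 i a : i \in a -> x i * xs a = 0.
Proof.
elim: a => // j a IH; rewrite inE xs_cons => /predU1P[->|ia]; first exact: xx0.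
by rewrite xxC IH // mulr0 oppr0.
Qed.

Lemma xs_nuniq a : ~~ uniq a -> xs a = 0.
Proof.
elim: a => // i a IH /=; rewrite negb_and negbK xs_cons => /orP[/x_xs0//|/IH ->].
by rewrite mulr0.
Qed.

Lemma alt_xs a : alt (xs a).
Proof.
elim: a => [|i a IH]; first by rewrite xs_nil => -[|? ?] ? ? ?; rewrite !wone_E oppr0.
by rewrite xs_cons; apply: alt_mul => //; apply: alt_gen.
Qed.

Definition q (a : seq nat) (k : nat) : W := xs a * v k.

Lemma q_nil k : q [::] k = v k. Proof. by rewrite /q xs_nil mul1r. Qed.
Lemma q_cons i a k : q (i :: a) k = x i * q a k.
Proof. by rewrite /q xs_cons mulrA. Qed.
Lemma q_cat a b k : q (a ++ b) k = xs a * q b k.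
Proof. by rewrite /q xs_cat mulrA. Qed.

Lemma par_q a k : par (~~ odd (size a)) (q a k).
Proof.
by rewrite -[~~ _]addbT; apply: par_mul (par_xs a) (par_Vw _ _).
Qed.

Lemma alt_q a k : alt (q a k).
Proof. by apply: alt_mul; [apply: alt_xs|apply: alt_Vw]. Qed.

Lemma tame_q a k : all (fun i => i < k)%N a -> tame (q a k).
Proof.
elim: a => [|i a IH] /=; first by rewrite q_nil => _; apply: tame_Vw.
move=> /andP[ik ak]; rewrite q_cons; apply: tame_gen_mul; last exact: IH.
by apply: high_mulr; apply: high_le (@high_Vw K k); apply: ltnW.
Qed.

Lemma der_q_y a k i : (i < k)%N -> der (true, i) (q a k) = 0.
Proof.
move=> ik; elim: a => [|j a IH]; first by rewrite q_nil der_Vw.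
by rewrite q_cons derM der_gen xpair_eqE /= mul0r IH mulr0 addr0.
Qed.

Lemma brN_xsl N a (b c : W) :
  (forall i, i \in a -> (i < N)%N /\ der (true, i) c = 0) ->
  brN N (xs a * b) c = xs a * brN N b c.
Proof.
elim: a => [|i a IH] h; first by rewrite xs_nil !mul1r.
have [iN ic] := h i (mem_head _ _).
rewrite xs_cons -!mulrA brN_xM // ic mulr0 addr0 IH // => j ja.
by apply: h; rewrite inE ja orbT.
Qed.

(** The letters x_i with i below k can only be contracted with y_i, which does not occur in V_l for
    l at least k. *)
Lemma brN_qv N a b k l : (k <= l)%N -> all (fun i => i < k)%N a -> (k < N)%N ->
  brN N (q a k) (q b l) = xs a * brN N (v k) (q b l).
Proof.
move=> kl /allP ak kN; apply: brN_xsl => i /ak ik.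
by rewrite der_q_y; [split=> //; exact: ltn_trans kN|exact: leq_trans kl].
Qed.

Lemma brN_v_xM N k j (h : W) :
  brN N (v k) (x j * h) = brN N (v k) (x j) * h - x j * brN N (v k) h.
Proof.
by rewrite (brN_Mr hK _ _ (par_Vw _ _) (par_gen _ _)) expr1 scaleN1r.
Qed.

Lemma brN_xsr N k a (h : W) : all (fun i => i < k)%N a ->
  brN N (v k) (xs a * h) = (-1) ^+ size a *: (xs a * brN N (v k) h).
Proof.
elim: a => [|i a IH] /=; first by rewrite xs_nil !mul1r scale1r.
move=> /andP[ik ak]; rewrite xs_cons -!mulrA brN_v_xM brN_vx_lt // mul0r add0r.
by rewrite IH // -scalerAr exprS mulN1r scaleNr.
Qed.
End Commutation.

(** * Reachable elements and the lower bound *)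

(** The recursion copies [lam^3 = lam + 2], so the cost grows like [lam^k]. The initial value 3 is
    the length 1 of a generator plus the 2 built into [reach]. *)
Fixpoint cost (k : nat) : nat :=
  match k with S (S ((S k') as k1)) => (2 * cost k' + cost k1)%N | _ => 3%N end.

Lemma costS3 k : cost k.+3 = (2 * cost k + cost k.+1)%N. Proof. by []. Qed.

Fixpoint jok (w : jword) : bool :=
  match w with JGen i => (i < 4)%N | JMul u v => jok u && jok v end.

(** Indices are treated by residue class modulo 3, because one construction step leads from V_k to
    V_{k+3}. *)
Definition prog (r n : nat) : seq nat := [seq (r + 3 * i)%N | i <- iota 0 n].

Lemma progS r n : prog r n.+1 = rcons (prog r n) (r + 3 * n).
Proof. by rewrite /prog -[n.+1]addn1 iotaD map_cat cats1. Qed.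

Lemma size_prog r n : size (prog r n) = n.
Proof. by rewrite size_map size_iota. Qed.

Section Reach.
Variable K : fieldType.
Local Notation W := (wfun K).
Local Notation x i := (gen K (false, i)).
Local Notation v i := (Vw K i).

Lemma br0l (g : W) : br 0 g = 0.
Proof. by rewrite -[0 in LHS](scale0r (0 : W)) br_Zl scale0r. Qed.

(* The cost is the length plus 2: it is then additive both for products and for
   brackets, [{a, b}] being [(a . bar 1) . (b . bar 1)] up to sign. *)
Definition reach (f : W) (n : nat) := exists w : jword,
  [/\ jok w, (jlen w + 2 <= n)%N & exists2 c : K, c != 0 & wjeval K w = (c *: f, 0)].

Lemma reach_le f n m : (n <= m)%N -> reach f n -> reach f m.
Proof. by move=> nm [w [jw lw h]]; exists w; split=> //; apply: leq_trans nm. Qed.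

Lemma reachZ c f n : c != 0 -> reach (c *: f) n -> reach f n.
Proof.
move=> c0 [w [jw lw [d d0 e]]]; exists w; split=> //.
by exists (d * c); rewrite ?mulf_neq0 // e scalerA.
Qed.

Lemma reachM f g n m : reach f n -> reach g m -> reach (f * g) (n + m).
Proof.
move=> [u [ju lu [c c0 eu]]] [w [jw lw [d d0 ew]]]; exists (JMul u w); split.
- by rewrite /= ju jw.
- by rewrite /=; lia.
exists (c * d); rewrite ?mulf_neq0 //= /wkmul eu ew /= br0l addr0 mul0r mulr0 addr0.
by rewrite -scalerAl -scalerAr scalerA.
Qed.

Lemma reach_br p f g n m : par p g -> reach f n -> reach g m -> reach (br f g) (n + m).
Proof.
move=> hg [u [ju lu [c c0 eu]]] [w [jw lw [d d0 ew]]].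
exists (JMul (JMul u (JGen 3)) (JMul w (JGen 3))); split.
- by rewrite /= ju jw.
- by rewrite /=; lia.
exists (c * (d * (-1) ^+ p)); first by rewrite !mulf_neq0 // signr_eq0.
rewrite /= /wkmul eu ew /= !br0l !(mul0r, mulr0, addr0, add0r, mulr1).
by rewrite linear0 mulr0 linearZ /= hg br_Zl !br_Zr !scalerA mulrA.
Qed.

Hypothesis hK : (2%:R : K) != 0.

(** The budget is that of V_k alone, whatever the set a. *)
Definition attain (a : seq nat) (k : nat) :=
  all (fun i => i < k)%N a /\ reach (q K a k) (cost k).

(** The bracket of the two elements leaves an extra x_{k+1}, which bracketing with V_{k+1} removes;
    the total is exactly [cost k.+3]. Reachability of V_{k+1} is a hypothesis so that the lemma can
    serve in the induction for [reach_v]. *)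
Lemma reach_merge a b k : attain a k -> attain b k -> reach (v k.+1) (cost k.+1) ->
  attain (a ++ b) k.+3.
Proof.
move=> [ak ra] [bk rb] rv.
have abk : all (fun i => i < k)%N (a ++ b) by rewrite all_cat ak.
have sub j : (k <= j)%N -> all (fun i => i < j)%N (a ++ b).
  by move=> kj; apply: sub_all abk => i /leq_trans; apply.
split; first by apply: sub; lia.
have r1 : reach (q K ((a ++ b) ++ [:: k.+1]) k.+3) (cost k + cost k).
  have := reach_br (par_q K b k) ra rb.
  rewrite (@br_eq_brN _ _ _ ((-1) ^+ size b *: (2%:R *: q K ((a ++ b) ++ [:: k.+1]) k.+3)) k.+2).
  - by move/reachZ; rewrite signr_eq0 => /(_ isT) /reachZ; apply.
  - exact: tame_q.
  - exact: tame_q.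
  move=> N kN; rewrite brN_qv //; last by lia.
  rewrite {1}/q (brN_xsr hK) // (brN_vv0 hK) // addn3 !q_cat q_cons q_nil xs_cat.
  by rewrite -!scalerAr mulrA.
have := reach_br (par_q K ((a ++ b) ++ [:: k.+1]) k.+3) rv r1.
rewrite (@br_eq_brN _ _ _ ((-1) ^+ size (a ++ b) *: q K (a ++ b) k.+3) k.+3).
- move/reachZ; rewrite signr_eq0 => /(_ isT); apply: reach_le.
  by rewrite costS3; lia.
- exact: tame_Vw.
- by apply: tame_q; rewrite all_cat sub ?/=; lia.
(* Only the contraction with x_{k+1} survives: the bracket of V_{k+1} with V_{k+3} starts with
   x_{k+1} and is multiplied by x_{k+1}. *)
move=> N kN; rewrite q_cat (brN_xsr hK); last by apply: sub; lia.
rewrite q_cons q_nil (brN_v_xM hK) // brN_vx // brN_vx_lt; last by lia.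
rewrite brN_vv_far // (xx0 hK) // eqxx !(mulr0, addr0, subr0) mul1r //.
Qed.

(** V_0, V_1, V_2 are generators; beyond them [reach_merge] is applied with both sets empty. *)
Lemma reach_v k : reach (v k) (cost k).
Proof.
elim/ltn_ind: k => -[|[|[|k]]] IH.
1-3: by [exists (JGen 0); split=> //; exists 1; rewrite ?oner_neq0 //= scale1r
        |exists (JGen 1); split=> //; exists 1; rewrite ?oner_neq0 //= scale1r
        |exists (JGen 2); split=> //; exists 1; rewrite ?oner_neq0 //= scale1r].
have h : attain [::] k by split=> //; rewrite q_nil; apply: IH; lia.
by have [|_] := reach_merge h h; rewrite ?q_nil //; apply: IH.
Qed.

Lemma attain_merge a b k : attain a k -> attain b k -> attain (a ++ b) k.+3.
Proof. by move=> ha hb; apply: reach_merge => //; apply: reach_v. Qed.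

Lemma attain_nil k : attain [::] k.
Proof. by split=> //; rewrite q_nil; apply: reach_v. Qed.

Lemma attain_keep a k : attain a k -> attain a k.+3.
Proof. by move=> /attain_merge /(_ (attain_nil k)); rewrite cats0. Qed.

Lemma attain_add a k : attain a k -> attain (rcons a k) k.+3.
Proof.
move=> [ak ra]; split.
  by rewrite all_rcons; apply/andP; split; [lia|apply: sub_all ak => i; lia].
have := reach_br (par_Vw K k.+1) ra (reach_v k.+1).
rewrite (@br_eq_brN _ _ _ (- 1 *: q K (rcons a k) k.+3) k.+3).
- move/reachZ; rewrite oppr_eq0 oner_eq0 => /(_ isT); apply: reach_le.
  by rewrite costS3; lia.
- exact: tame_q.
- exact: tame_Vw.
move=> N kN; rewrite -{1}[v k.+1](q_nil K) brN_qv //; last by lia.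
by rewrite q_nil (brN_vv1 hK) // addn3 -cats1 q_cat q_cons q_nil mulrN scaleN1r.
Qed.

(** A shift by 2 changes the residue class, which allows the three progressions to be brought to a
    common k. With j = k - 1, half the bracket of V_j with itself is x_k V_{k+2}, and bracketing x^a
    V_k with it contracts x_k; the cost is [2 * cost j + cost k], that is, [cost k.+2]. *)
Lemma attain_shift2 a k : (0 < k)%N -> attain a k -> attain a k.+2.
Proof.
case: k => // j _; set k := j.+1 => -[ak ra].
split; first by apply: sub_all ak => i; lia.
have r1 : reach (q K [:: k] k.+2) (cost j + cost j).
  have := reach_br (par_Vw K j) (reach_v j) (reach_v j).
  rewrite (@br_eq_brN _ _ _ (2%:R *: q K [:: k] k.+2) k.+2).
  - by move/reachZ; apply.
  - exact: tame_Vw.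
  - exact: tame_Vw.
  by move=> N kN; rewrite (brN_vv0 hK) // ?q_cons ?q_nil ?addn3 //; lia.
have := reach_br (par_q K [:: k] k.+2) ra r1.
rewrite (@br_eq_brN _ _ _ (q K a k.+2) k.+3).
- by apply: reach_le; rewrite /k costS3; lia.
- exact: tame_q.
- by apply: tame_q => /=; lia.
move=> N kN; rewrite brN_qv //; try by lia.
rewrite q_cons q_nil (brN_v_xM hK) // brN_vx; last by lia.
rewrite brN_vx_lt; last by lia.
by rewrite brN_vv_far ?(xx0 hK) ?eqxx ?(mulr0, addr0, subr0) ?mul1r //; lia.
Qed.

(** Each passage from k to k + 3 either adjoins x_k or keeps the set, as the current bit
    prescribes. *)
Lemma attain_prog r s :
  attain (mask s (prog r (size s))) (r + 3 * size s).
Proof.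
elim/last_ind: s => [|s b IH]; first exact: attain_nil.
rewrite size_rcons progS mask_rcons ?size_prog //.
have -> : (r + 3 * (size s).+1 = (r + 3 * size s).+3)%N by lia.
by case: b; [rewrite cats1; apply: attain_add|rewrite cats0; apply: attain_keep].
Qed.

Lemma attain_subset m s0 s1 s2 : size s0 = m -> size s1 = m -> size s2 = m ->
  attain (mask s0 (prog 0 m) ++ mask s1 (prog 1 m) ++ mask s2 (prog 2 m)) (3 * m + 12).
Proof.
move=> e0 e1 e2.
(* Shifts by 6, 5 and 7 take the classes 0, 1, 2 to 3m+6, 3m+6 and 3m+9. Merging the first two gives
   3m+9, and merging with the third gives 3m+12. *)
have := attain_prog 0 s0; rewrite e0 => /attain_keep /attain_keep h0.
have := attain_prog 1 s1; rewrite e1 => /attain_shift2 => /(_ isT) /attain_keep h1.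
have := attain_prog 2 s2; rewrite e2 => /attain_shift2 => /(_ isT) /attain_shift2.
move=> /(_ isT) /attain_keep h2.
have := attain_merge (attain_merge h0 h1) h2.
have -> : (3 * m + 12 = (0 + 3 * m).+3.+3.+3.+3)%N by lia.
by rewrite catA.
Qed.

Lemma reach_prod_v (b : bitseq) (r : seq nat) f n : reach f n ->
  reach ((\prod_(j <- mask b r) v j) * f) (n + \sum_(j <- r) cost j).
Proof.
move=> rf; elim: r b => [|j r IH] [|c b].
- by rewrite [mask _ _]/= [X in X * _]big_nil mul1r; apply: reach_le rf; lia.
- by rewrite [mask _ _]/= [X in X * _]big_nil mul1r; apply: reach_le rf; lia.
- by rewrite [mask _ _]/= [X in X * _]big_nil mul1r; apply: reach_le rf; lia.
rewrite big_cons; case: c => /=.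
  rewrite big_cons -mulrA; apply: reach_le (reachM (reach_v j) (IH b)).
  by rewrite addnCA.
by apply: reach_le (IH b); lia.
Qed.
End Reach.

(** * Enumeration of Jordan words by length *)

HB.instance Definition _ := gen_eqMixin jword.

Lemma jlen_gt0 w : (0 < jlen w)%N.
Proof. by elim: w => //= u IHu v _; rewrite ltn_addr. Qed.

Lemma jwordsS n : jwords n.+1 = map JGen (iota 0 4) ++
  [seq w <- allpairs JMul (jwords n) (jwords n) | (jlen w <= n.+1)%N].
Proof. by []. Qed.

Lemma mem_jwords w n : jok w -> (jlen w <= n)%N -> w \in jwords n.
Proof.
elim: n w => [|n IH] w jw lw.
  by move: lw; rewrite leqNgt jlen_gt0.
rewrite jwordsS mem_cat.
case: w jw lw => [i jw _|u v].
  by apply/orP; left; apply: map_f; rewrite mem_iota.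
move=> /= /andP[ju jv] lw; apply/orP; right; rewrite mem_filter /= lw /=.
have := jlen_gt0 u; have := jlen_gt0 v => pu pv.
by apply: allpairs_f; apply: IH => //; lia.
Qed.

Lemma jlen_jwords w n : w \in jwords n -> (jlen w <= n)%N.
Proof.
case: n => // n; rewrite jwordsS mem_cat.
case/orP => [/mapP[i _ ->]//|].
by rewrite mem_filter => /andP[].
Qed.

(** * Lower bounds for the dimension of a span *)

Section SpanDim.
Variable K : fieldType.

Lemma big_zip_map (I : eqType) (R : nmodType) (T : seq I) (a : I -> K) (F : K -> I -> R) :
  \sum_(p <- zip (map a T) T) F p.1 p.2 = \sum_(t <- T) F (a t) t.
Proof. by elim: T => [|t T IH]; rewrite ?big_nil //= !big_cons IH. Qed.

Definition free_family (T : seq (kelt K)) := forall a : kelt K -> K,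
  (forall m, \sum_(t <- T) a t * t.1 m = 0 /\ \sum_(t <- T) a t * t.2 m = 0) ->
  forall t, t \in T -> a t = 0.

Lemma lin_indep_free T : uniq T -> free_family T -> lin_indep T.
Proof.
move=> uT fT c sc hc; pose a t := nth 0 c (index t T).
have ec : c = map a T.
  case: T uT sc @a {fT hc} => [|t0 T] uT sc a; first by case: c sc @a.
  apply: (@eq_from_nth _ 0); first by rewrite size_map sc.
  by move=> i; rewrite sc => iT; rewrite (nth_map t0) // /a index_uniq.
rewrite ec all_map; apply/allP => t tT; apply/eqP; apply: fT tT => m.
have := hc m; rewrite ec.
by rewrite (big_zip_map T a (fun b s => b * s.1 m)) (big_zip_map T a (fun b s => b * s.2 m)).
Qed.

(** [span_dim] ranges over sublists of L in their given order, so T is first rearranged into a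
    sublist of [undup L]. *)
Lemma span_dim_ge (T L : seq (kelt K)) : uniq T -> {subset T <= L} -> free_family T ->
  (size T <= span_dim L)%N.
Proof.
move=> uT TL fT; pose T' := [seq t <- undup L | t \in T].
have pT : perm_eq T' T.
  apply: uniq_perm => //; first by rewrite filter_uniq // undup_uniq.
  by move=> t; rewrite mem_filter mem_undup; case: (boolP (t \in T)) => // /TL ->.
have /subseqP[ms sms eT] : subseq T' L.
  exact: subseq_trans (filter_subseq _ _) (undup_subseq _).
rewrite -(perm_size pT) eT.
rewrite /span_dim; apply: leq_bigmax_seq; first by rewrite mem_bitseqs sms.
apply/asboolP; rewrite -eT; apply: lin_indep_free.
  by rewrite (perm_uniq pT).
move=> a ha t; rewrite (perm_mem pT); apply: fT => m.
by have := ha m; rewrite !(perm_big _ pT).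
Qed.
End SpanDim.

(** * Independence of products of triangular families *)

Section Independence.
Variable K : fieldType.
Local Notation W := (wfun K).
Local Notation x i := (gen K (false, i)).
Local Notation v i := (Vw K i).

Fixpoint triangular (gl : seq (W * letter)) : Prop :=
  if gl is (g, l) :: r then
    [/\ der l g = 1, (forall p, List.In p r -> der l p.1 = 0) & triangular r]
  else True.

Definition mprod (s : bitseq) (gs : seq W) : W := \prod_(g <- mask s gs) g.

Lemma der_mprod0 l s (gl : seq (W * letter)) :
  (forall p, List.In p gl -> der l p.1 = 0) -> der l (mprod s (map fst gl)) = 0.
Proof.
rewrite /mprod; elim: gl s => [|p gl IH] [|b s] h; rewrite ?mask0 ?big_nil //=.
have IH' := IH s (fun p' h' => h p' (or_intror h')).
case: b => /=; last exact: IH'.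
by rewrite big_cons derM IH' h ?mul0r ?mulr0 ?addr0 //; left.
Qed.

(** A relation has the form g A + B = 0 with A and B combinations of products of the later factors.
    Applying [der l] returns A, so A = 0 and then B = 0. *)
Lemma mprod_free (gl : seq (W * letter)) (c : bitseq -> K) : triangular gl ->
  \sum_(s <- bitseqs (size gl)) c s *: mprod s (map fst gl) = 0 ->
  forall s, size s = size gl -> c s = 0.
Proof.
elim: gl c => [|[g l] gl IH] c.
  move=> _; rewrite big_seq1 /mprod big_nil => /(congr1 (fun f : W => f [::])).
  by rewrite wscaleE wone_E eqxx mulr1 => h [].
move=> [dg dr tr]; rewrite /size -/size bitseqsS big_cat !big_map.
have -> : \sum_(s <- bitseqs (size gl)) c (true :: s) *: mprod (true :: s) (map fst ((g, l) :: gl))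
   = g * \sum_(s <- bitseqs (size gl)) c (true :: s) *: mprod s (map fst gl).
  rewrite mulr_sumr; apply: eq_bigr => s _.
  by rewrite -scalerAr /mprod /= big_cons.
have -> : \sum_(s <- bitseqs (size gl)) c (false :: s) *: mprod (false :: s) (map fst ((g, l) :: gl))
   = \sum_(s <- bitseqs (size gl)) c (false :: s) *: mprod s (map fst gl).
  by apply: eq_bigr => s _.
set A := \sum_(_ <- _) _; set B := \sum_(_ <- _) _ => e.
have d0 (d : bitseq -> K) : der l (\sum_(s <- bitseqs (size gl)) d s *: mprod s (map fst gl)) = 0.
  by rewrite linear_sum big1 // => s _; rewrite linearZ /= der_mprod0 ?scaler0.
have A0 : A = 0.
  have := congr1 (der l) e; rewrite derD derM dg mul1r.
  by rewrite /A /B !d0 mulr0 !addr0 der0.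
have B0 : B = 0 by move: e; rewrite A0 mulr0 /= add0r.
by case=> // -[] s [ss]; [apply: (IH (fun s => c (true :: s)))|apply: (IH (fun s => c (false :: s)))].
Qed.

(** V_j is detected by y_j and x_i by itself. The V_j come first because y_j does not occur in any
    x_i, whereas V_j does involve x letters. *)
Definition vx_list (js a : seq nat) : seq (W * letter) :=
  [seq (v j, (true, j)) | j <- js] ++ [seq (x i, (false, i)) | i <- a].

Lemma In_map (A : eqType) (B : Type) (f : A -> B) s b :
  List.In b (map f s) -> exists2 c, c \in s & b = f c.
Proof.
elim: s => //= c s IH [<-|/IH[d ds ->]]; first by exists c; rewrite ?mem_head.
by exists d; rewrite // inE ds orbT.
Qed.

Lemma vx_list_triangular js a : sorted ltn js -> uniq a -> triangular (vx_list js a).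
Proof.
move=> + ua; elim: js => [_|j js IH /= sj]; last first.
  split; [exact: der_v_y| |exact: IH (path_sorted sj)].
  move=> p hp; case: (@List.in_app_or _ _ _ _ hp) => h; have [k kj ->] := In_map h.
    apply: der_Vw => /=; move: sj; rewrite (path_sortedE ltn_trans) => /andP[/allP lt_j _].
    exact: lt_j.
  by rewrite der_gen xpair_eqE.
rewrite /vx_list /=; elim: a ua => //= i a IH /andP[ia ua].
split; [by rewrite der_gen eqxx| |exact: IH].
move=> p h; have [k ka ->] := In_map h; rewrite der_gen xpair_eqE /=.
by case: eqP => // e; move: ia; rewrite e ka.
Qed.
End Independence.

Section AltClosure.
Variable K : fieldType.
Local Notation W := (wfun K).

Lemma alt0 : alt (0 : W). Proof. by move=> *; rewrite !wfun0E oppr0. Qed.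
Lemma alt1 : alt (1 : W).
Proof. by move=> [|? ?] ? ? ?; rewrite !wone_E oppr0. Qed.
Lemma altD (f g : W) : alt f -> alt g -> alt (f + g).
Proof. by move=> af ag u a b v; rewrite !wfunDE af ag opprD. Qed.
Lemma altZ c (f : W) : alt f -> alt (c *: f).
Proof. by move=> af u a b v; rewrite !wscaleE af mulrN. Qed.
End AltClosure.

(** * The lower bound for the growth function *)

Section LowerBound.
Variable K : fieldType.
Local Notation W := (wfun K).
Local Notation x i := (gen K (false, i)).
Local Notation v i := (Vw K i).

Lemma restr_inj (hK : (2%:R : K) != 0) (f g : W) :
  alt f -> alt g -> restr f = restr g -> f = g.
Proof.
move=> af ag e; apply/eqP; rewrite -subr_eq0; apply/eqP.
apply: (alt_canon0 hK); first by rewrite -scaleN1r; apply: altD => //; apply: altZ.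
move=> m cm; have /(congr1 (fun h : elt K => h m)) := e.
by rewrite /restr cm wfunDE wfunNE => ->; rewrite subrr.
Qed.

(** Masks with bit k set: the factor at position k is to be taken in every product, the others
    freely. *)
Definition full (k : nat) (t : bitseq) : bitseq := take k t ++ true :: drop k t.
Definition unfull (k : nat) (u : bitseq) : bitseq := take k u ++ drop k.+1 u.

Lemma fullK k t : (k <= size t)%N -> unfull k (full k t) = t.
Proof.
move=> kt; rewrite /unfull /full take_cat drop_cat size_takel // ltnn subnn take0 cats0.
by rewrite ltnNge leqnSn /= subSnn /= drop0 cat_take_drop.
Qed.

Lemma unfullK k u : (k < size u)%N -> nth false u k -> full k (unfull k u) = u.
Proof.
move=> ku hu; rewrite /unfull /full take_cat drop_cat size_takel ?(ltnW ku) // ltnn subnn.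
by rewrite take0 cats0 drop0 -hu -drop_nth // cat_take_drop.
Qed.

Lemma nth_full k t : (k <= size t)%N -> nth false (full k t) k.
Proof. by move=> kt; rewrite /full nth_cat size_takel // ltnn subnn. Qed.

Lemma size_full k t : (k <= size t)%N -> size (full k t) = (size t).+1.
Proof.
by move=> kt; rewrite /full size_cat /= size_takel // size_drop; lia.
Qed.

Lemma size_unfull k u : (k < size u)%N -> size (unfull k u) = (size u).-1.
Proof. by move=> ku; rewrite /unfull size_cat size_takel ?(ltnW ku) // size_drop; lia. Qed.

Lemma sum_full k n (F : bitseq -> W) : (k <= n)%N ->
  \sum_(u <- bitseqs n.+1 | nth false u k) F u = \sum_(t <- bitseqs n) F (full k t).
Proof.
move=> kn; rewrite -big_filter -(big_map (full k) xpredT); apply: perm_big.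
apply: uniq_perm.
- by rewrite filter_uniq // uniq_bitseqs.
- rewrite map_inj_in_uniq ?uniq_bitseqs // => s t; rewrite !mem_bitseqs => /eqP ss /eqP st e.
  by rewrite -(@fullK k s) ?ss // e fullK ?st.
move=> u; rewrite mem_filter mem_bitseqs; apply/andP/mapP => [[hu /eqP su]|[t]].
  exists (unfull k u); last by rewrite unfullK // su.
  by rewrite mem_bitseqs size_unfull su.
rewrite mem_bitseqs => /eqP st ->.
by rewrite nth_full ?size_full ?st.
Qed.

Lemma uniq_prog r n : uniq (prog r n).
Proof. by rewrite map_inj_uniq ?iota_uniq // => i j; lia. Qed.

Lemma uniq_progs n : uniq (prog 0 n ++ prog 1 n ++ prog 2 n).
Proof.
rewrite !cat_uniq !uniq_prog /= andbT; apply/andP; split.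
  apply/hasPn => i; rewrite mem_cat => /orP[] /mapP[j _ ->];
    by apply/negP => /mapP[l _]; lia.
by apply/hasPn => i /mapP[j _ ->]; apply/negP => /mapP[l _]; lia.
Qed.

Hypothesis hK : (2%:R : K) != 0.

(** The compulsory factor V_{3m+12} stands at position 3m, after V_j for j < 3m and before x_i for i
    < 3m; this leaves 6m free factors. *)
Definition lower_list (m : nat) : seq (W * letter) :=
  vx_list K (iota 0 (3 * m) ++ [:: (3 * m + 12)%N]) (prog 0 m ++ prog 1 m ++ prog 2 m).

Lemma lower_list_triangular m : triangular (lower_list m).
Proof.
apply: vx_list_triangular; last exact: uniq_progs.
rewrite cats1; move: (iota_ltn_sorted 0 (3 * m)).
case E: (iota 0 (3 * m)) => [|a s] //= h.
rewrite rcons_path h /=.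
have : last a s \in iota 0 (3 * m) by rewrite E mem_last.
by rewrite mem_iota; lia.
Qed.

Lemma size_lower_list m : size (lower_list m) = (6 * m).+1.
Proof.
by rewrite /lower_list /vx_list !(size_cat, size_map, size_prog, size_iota) /=; lia.
Qed.

Lemma reach_lower m t : size t = (6 * m)%N ->
  reach (mprod (full (3 * m) t) (map fst (lower_list m)))
        (cost (3 * m + 12) + \sum_(j <- iota 0 (3 * m)) cost j).
Proof.
move=> st; set k := (3 * m)%N.
have -> : map fst (lower_list m) = map (fun j => v j) (iota 0 k)
   ++ v (k + 12) :: map (fun i => x i) (prog 0 m ++ prog 1 m ++ prog 2 m).
  by rewrite /lower_list /vx_list !map_cat -!map_comp -!catA.
have sk : size (take k t) = k by rewrite size_takel // st /k; lia.
rewrite /mprod /full mask_cat ?size_map ?size_iota // big_cat /= big_cons -!map_mask !big_map.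
set s := drop k t; set a := mask s _.
(* The products have V_{3m+12} in front of x^a, while [attain] has it behind; the exchange costs a
   sign. *)
have e : v (k + 12) * xs K a = (-1) ^+ (odd (size a)) *: q K a (k + 12).
  by rewrite (supercomm hK (par_Vw _ _) (par_xs _ _)).
rewrite -/(xs K a) e -scalerAr; apply: (@reachZ _ ((-1) ^+ odd (size a))).
  by rewrite signr_eq0.
rewrite scalerA -expr2 sqrr_sign scale1r.
apply: reach_prod_v => //.
have ss : size s = (3 * m)%N by rewrite size_drop st /k; lia.
have -> : a = mask (take m s) (prog 0 m) ++ mask (take m (drop m s)) (prog 1 m)
   ++ mask (drop m (drop m s)) (prog 2 m).
  rewrite /a -{1}(cat_take_drop m s) -{1}(cat_take_drop m (drop m s)).
  by rewrite !mask_cat ?size_prog // size_takel ?size_drop ?ss //; lia.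
by apply: (attain_subset hK _ _ _).2; rewrite ?size_takel ?size_drop ?ss //; lia.
Qed.

Lemma lower_free m (d : bitseq -> K) :
  \sum_(t <- bitseqs (6 * m)) d t *: mprod (full (3 * m) t) (map fst (lower_list m)) = 0 ->
  forall t, size t = (6 * m)%N -> d t = 0.
Proof.
move=> e t st; have tm : (3 * m <= size t)%N by rewrite st; lia.
(* The coefficients are extended by 0 to masks omitting V_{3m+12}, so that [mprod_free] applies to
   the whole family. *)
pose c u := if nth false u (3 * m) then d (unfull (3 * m) u) else 0.
have h : \sum_(u <- bitseqs (size (lower_list m))) c u *: mprod u (map fst (lower_list m)) = 0.
  rewrite -[RHS]e size_lower_list.
  transitivity (\sum_(u <- bitseqs (6 * m).+1 | nth false u (3 * m))
     d (unfull (3 * m) u) *: mprod u (map fst (lower_list m))).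
    rewrite [RHS]big_mkcond; apply: eq_bigr => u _; rewrite /c.
    by case: ifP; rewrite ?scale0r.
  rewrite sum_full; last by lia.
  apply: eq_big_seq => u; rewrite mem_bitseqs => /eqP su.
  by rewrite fullK // su; lia.
have := mprod_free (lower_list_triangular m) h (s := full (3 * m) t).
by rewrite /c nth_full // fullK // size_full // st size_lower_list; apply.
Qed.

Lemma alt_mprod_lower m s : alt (mprod s (map fst (lower_list m))).
Proof.
have : forall p, List.In p (lower_list m) -> alt p.1.
  move=> p hp; case: (@List.in_app_or _ _ _ _ hp) => h; have [k _ ->] := In_map h.
    exact: alt_Vw.
  exact: alt_gen.
rewrite /mprod; elim: (lower_list m) s => [|p gl IH] [|b s] h; rewrite ?mask0 ?big_nil //=;
  try exact: alt1.
have IH' := IH s (fun p' h' => h p' (or_intror h')).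
by case: b => //=; rewrite big_cons; apply: alt_mul => //; apply: h; left.
Qed.

Lemma gamma_ge m n : (forall u, alt (wjeval K u).2) ->
  (cost (3 * m + 12) + \sum_(j <- iota 0 (3 * m)) cost j <= n)%N ->
  (2 ^ (6 * m) <= gamma K n)%N.
Proof.
move=> hj hn; pose P t := mprod (full (3 * m) t) (map fst (lower_list m)).
(* Masks of the wrong length get the default word [JGen 0]. *)
have /choice[wd hwd] : forall t, exists w, size t = (6 * m)%N ->
    [/\ jok w, (jlen w <= n)%N & exists2 c : K, c != 0 & wjeval K w = (c *: P t, 0)].
  move=> t; case: (eqVneq (size t) (6 * m)%N) => [st|/eqP ne]; last by exists (JGen 0).
  have [w [jw lw hw]] := reach_lower st.
  by exists w => _; split=> //; lia.
pose f t := (wjeval K (wd t)).1.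
have fE t : size t = (6 * m)%N -> exists2 c : K, c != 0 & f t = c *: P t.
  by move=> /hwd[_ _ [c c0 e]]; exists c; rewrite // /f e.
have f2 t : size t = (6 * m)%N -> (wjeval K (wd t)).2 = 0.
  by move=> /hwd[_ _ [c c0 ->]].
have ffree (d : bitseq -> K) : \sum_(t <- bitseqs (6 * m)) d t *: f t = 0 ->
    forall t, size t = (6 * m)%N -> d t = 0.
  have /choice[c hc] : forall t, exists c : K, size t = (6 * m)%N -> c != 0 /\ f t = c *: P t.
    move=> t; case: (eqVneq (size t) (6 * m)%N) => [/fE[c c0 e]|/eqP ne]; last by exists 0.
    by exists c.
  move=> e t st; have [c0 _] := hc t st; apply: (mulIf c0); rewrite mul0r.
  apply: (@lower_free m (fun t => d t * c t)) => //; rewrite -[RHS]e.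
  apply: eq_big_seq => u; rewrite mem_bitseqs => /eqP su.
  by have [_ ->] := hc u su; rewrite scalerA.
have falt t : size t = (6 * m)%N -> alt (f t).
  by move=> /fE[c _ ->]; apply: altZ; apply: alt_mprod_lower.
have jE t : jeval K (wd t) = (restr (f t), restr (wjeval K (wd t)).2) by apply: jeval_restr.
pose T := [seq jeval K (wd t) | t <- bitseqs (6 * m)].
have -> : (2 ^ (6 * m) = size T)%N by rewrite size_map size_bitseqs.
apply: span_dim_ge.
(* Two masks with the same image would give a relation with coefficients 1 and -1, against
   independence. *)
- rewrite map_inj_in_uniq ?uniq_bitseqs // => s t; rewrite !mem_bitseqs => /eqP ss /eqP st.
  rewrite !jE => -[/(restr_inj hK (falt _ ss) (falt _ st)) e _].
  apply/eqP; case: (eqVneq s t) => // ne.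
  have : (1 : K) = 0; last by move/eqP; rewrite oner_eq0.
  have pick w : size w = (6 * m)%N ->
      \sum_(u <- bitseqs (6 * m)) (u == w)%:R *: f u = f w.
    move=> sw; rewrite (bigD1_seq w) ?mem_bitseqs ?sw ?uniq_bitseqs //= eqxx scale1r.
    by rewrite big1 ?addr0 // => u /negbTE ->; rewrite scale0r.
  pose d u : K := (u == s)%:R - (u == t)%:R.
  have <- : d s = 1 by rewrite /d eqxx (negbTE ne) subr0.
  apply: ffree => //; rewrite /d; under eq_bigr do rewrite scalerBl.
  by rewrite sumrB !pick // e subrr.
- move=> j /mapP[t]; rewrite mem_bitseqs => /eqP /hwd[jw lw _] ->.
  by apply: map_f; apply: mem_jwords.
move=> a ha j /mapP[t]; rewrite mem_bitseqs => /eqP st ->.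
apply: (ffree (fun t => a (jeval K (wd t)))) => //.
have E (u : bitseq) : u \in bitseqs (6 * m) -> alt (f u) by rewrite mem_bitseqs => /eqP /falt.
(* The relation is known on sorted words only; alternation extends it to all words. *)
apply: (alt_canon0 hK).
  by rewrite big_seq; elim/big_ind: _ => //; [exact: alt0|exact: altD|move=> u /E; apply: altZ].
move=> w cw; have [+ _] := ha w; rewrite big_map => h0; rewrite wfun_sumE -[RHS]h0.
apply: eq_bigr => u _; rewrite wscaleE; congr (_ * _).
by rewrite jE /= /restr cw.
Qed.
End LowerBound.

(** * The weight filtration and the upper bound *)

Section LinearSpan.
Variables (K : fieldType) (U : lmodType K).

Inductive lspan (S : U -> Prop) : U -> Prop :=
| Lspan0 : lspan S 0
| LspanC c f g : S f -> lspan S g -> lspan S (c *: f + g).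

Lemma lspan_in S f : S f -> lspan S f.
Proof. by move=> Sf; rewrite -[f]addr0 -[f]scale1r; apply: LspanC => //; apply: Lspan0. Qed.
Lemma lspanD S f g : lspan S f -> lspan S g -> lspan S (f + g).
Proof.
by move=> hf hg; elim: hf => [|c f1 f2 Sf _ IH]; rewrite ?add0r // -addrA; apply: LspanC.
Qed.
Lemma lspanZ S c f : lspan S f -> lspan S (c *: f).
Proof.
elim=> [|d f1 f2 Sf _ IH]; first by rewrite scaler0; apply: Lspan0.
by rewrite scalerDr scalerA; apply: LspanC.
Qed.
Lemma lspan_sum S (I : eqType) (r : seq I) (F : I -> U) :
  (forall i, i \in r -> lspan S (F i)) -> lspan S (\sum_(i <- r) F i).
Proof.
move=> h; rewrite big_seq; elim/big_ind: _ => //; [exact: Lspan0|exact: lspanD].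
Qed.
End LinearSpan.

(** * Brackets of the elements x^a V_k and their weights *)

Section Closure.
Variable K : fieldType.
Local Notation W := (wfun K).
Local Notation x i := (gen K (false, i)).
Local Notation v i := (Vw K i).

Lemma lspan_bilin (S T Z : W -> Prop) (B : W -> W -> W) :
  (forall f f' g, B (f + f') g = B f g + B f' g) ->
  (forall f g g', B f (g + g') = B f g + B f g') ->
  (forall c f g, B (c *: f) g = c *: B f g) ->
  (forall c f g, B f (c *: g) = c *: B f g) ->
  (forall f g, S f -> T g -> lspan Z (B f g)) ->
  forall f g, lspan S f -> lspan T g -> lspan Z (B f g).
Proof.
move=> Dl Dr Zl Zr h f g hf hg; elim: hf => [|c f1 f2 Sf _ IH].
  by rewrite -[0](scale0r (0 : W)) Zl scale0r; apply: Lspan0.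
rewrite Dl Zl; apply: lspanD => //; apply: lspanZ.
elim: hg => [|d g1 g2 Tg _ IHg].
  by rewrite -[0](scale0r (0 : W)) Zr scale0r; apply: Lspan0.
by rewrite Dr Zr; apply: lspanD => //; apply: lspanZ; apply: h.
Qed.

Variables (R : realFieldType) (lam : R).

Definition xwt (a : seq nat) : R := \sum_(i <- a) lam ^+ i.
Definition qwt (p : seq nat * nat) : R := lam ^+ p.2 - xwt p.1.

Lemma xwt_cons i a : xwt (i :: a) = lam ^+ i + xwt a. Proof. exact: big_cons. Qed.
Lemma xwt_nil : xwt [::] = 0. Proof. exact: big_nil. Qed.
Lemma xwt_cat a b : xwt (a ++ b) = xwt a + xwt b. Proof. exact: big_cat. Qed.

(* The second condition keeps the weight of [x^a V_k] bounded below by a multiple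
   of [lam ^ k]; it excludes the tail [x_{k-3} x_{k-2} V_k] of [V_{k-3}]. *)
Definition adm (p : seq nat * nat) : bool :=
  all (fun i => i.+1 < p.2)%N p.1 &&
  ~~ (has (fun i => i.+2 == p.2)%N p.1 && has (fun i => i.+3 == p.2)%N p.1).

Lemma brN_1r N (f : W) : brN N f 1 = 0.
Proof. by rewrite /brN big1 // => i _; rewrite !der1 !mulr0 addr0. Qed.
Lemma brN_1l N (f : W) : brN N 1 f = 0.
Proof. by rewrite /brN big1 // => i _; rewrite !der1 !linear0 !mul0r addr0. Qed.

Hypothesis lamE : lam ^+ 3 = lam + 2.

Lemma lam3 k : lam ^+ (k + 3) = lam ^+ k.+1 + 2 * lam ^+ k.
Proof. by rewrite exprD lamE mulrDr -exprSr [_ * 2]mulrC. Qed.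

(** The bracket is the coefficient of y_j in V_k: zero unless j = k + 3s, and then the product of
    x_{k+3n} x_{k+3n+1} for n < s, whose indices are at most j - 2. *)
Lemma brN_vx_form k j : exists c : K, exists a, 
  (forall N, (j.+1 < N)%N -> brN N (v k) (x j) = c *: xs K a) /\
  (c != 0 -> [/\ (k <= j)%N, all (fun i => i.+1 < j)%N a & xwt a = lam ^+ j - lam ^+ k]).
Proof.
have [n] := ubnP (j - k); elim: n k => // n IH k jk.
case: (ltngtP j k) => [lt|lt|e].
- exists 0, [::]; rewrite eqxx; split=> // N _.
  by rewrite brN_vx_lt // scale0r.
- have [|c [a [h1 h2]]] := IH (k + 3)%N; first by lia.
  exists c, [:: k, k.+1 & a]; split=> [N jN|/h2[kj aj wa]].
    rewrite brN_vx; last by lia.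
    by rewrite h1 // (ltn_eqF lt) add0r !xs_cons -!scalerAr.
  split; [by lia| |]; first by rewrite /= aj andbT; apply/andP; split; lia.
  by rewrite !xwt_cons wa lam3; ring.
exists 1, [::]; split=> [N jN|_]; last by rewrite xwt_nil e subrr.
rewrite brN_vx ?e // -?e // brN_vx_lt ?e; last by lia.
by rewrite eqxx !mulr0 addr0 xs_nil scale1r.
Qed.

Hypothesis hK : (2%:R : K) != 0.

Lemma brN_vxs_form k b : exists L : seq (K * seq nat),
  (forall N, (forall j, j \in b -> (j.+1 < N)%N) ->
     brN N (v k) (xs K b) = \sum_(p <- L) p.1 *: xs K p.2) /\
  (forall p, p \in L -> [/\ exists2 j, j \in b & (k <= j)%N,
     (forall i, i \in p.2 -> i \in b \/ exists2 j, j \in b & (i.+1 < j)%N)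
     & xwt p.2 = xwt b - lam ^+ k]).
Proof.
elim: b => [|j b [L [h1 h2]]].
  by exists [::]; split=> // N _; rewrite big_nil xs_nil brN_1r.
have [c [a [g1 g2]]] := brN_vx_form k j.
(* By Leibniz, either x_j is replaced by its bracket or it is kept with a sign. A zero bracket is
   left out of the list, since its word need not have the right weight. *)
exists ((if c == 0 then [::] else [:: (c, a ++ b)]) ++ [seq (- p.1, j :: p.2) | p <- L]).
split=> [N hN|p].
  rewrite xs_cons (brN_v_xM hK) g1 ?hN ?mem_head // h1; last first.
    by move=> i ib; apply: hN; rewrite inE ib orbT.
  rewrite big_cat big_map mulr_sumr -sumrN; congr (_ + _).
    case: eqP => [->|_]; first by rewrite scale0r mul0r big_nil.
    by rewrite big_seq1 -scalerAl xs_cat.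
  by apply: eq_bigr => p _; rewrite xs_cons scaleNr scalerAr.
rewrite mem_cat => /orP[|/mapP[p' /h2[[i ib ki] hp wp] ->] /=].
  case: eqP => // /eqP /g2[kj aj wa]; rewrite inE => /eqP -> /=; split.
  - by exists j; rewrite ?mem_head.
  - move=> i; rewrite mem_cat => /orP[/(allP aj) ij|ib].
      by right; exists j; rewrite ?mem_head.
    by left; rewrite inE ib orbT.
  by rewrite xwt_cat wa xwt_cons; ring.
split.
- by exists i; rewrite // inE ib orbT.
- move=> l; rewrite inE => /predU1P[->|/hp[lb|[i' i'b li]]].
  + by left; rewrite mem_head.
  + by left; rewrite inE lb orbT.
  by right; exists i'; rewrite // inE i'b orbT.
by rewrite !xwt_cons wp; ring.
Qed.

(** While l is at least k + 3, a factor x_k x_{k+1} splits off and k moves to k + 3; this ends at l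
    - k in {0, 1, 2}, where the bracket is explicit. *)
Lemma brN_vv_form k l : (k <= l)%N -> exists c : K, exists p,
  [/\ (forall N, (l + 5 < N)%N -> brN N (v k) (v l) = c *: q K p.1 p.2),
      (l + 2 <= p.2)%N, adm p & qwt p = lam ^+ k + lam ^+ l].
Proof.
move=> kl; have [n] := ubnP (l - k); elim: n k kl => // n IH k kl lk.
have [e|[e|[e|e]]] : l = k \/ l = k.+1 \/ l = k.+2 \/ (k + 3 <= l)%N by lia.
- exists 2%:R, ([:: k.+1], (k + 3)%N); split=> [N lN|/=|/=|].
  + by rewrite e (brN_vv0 hK) ?q_cons ?q_nil //; lia.
  + by lia.
  + by rewrite /adm /=; lia.
  by rewrite /qwt /= xwt_cons xwt_nil lam3 e; ring.
- exists (- 1), ([:: k], (k + 3)%N); split=> [N lN|/=|/=|].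
  + by rewrite e (brN_vv1 hK) ?q_cons ?q_nil ?scaleN1r //; lia.
  + by lia.
  + by rewrite /adm /=; lia.
  by rewrite /qwt /= xwt_cons xwt_nil lam3 e; ring.
- exists (- 1), ([:: k; k.+1; k.+2], (k + 5)%N); split=> [N lN|/=|/=|].
  + by rewrite e (brN_vv2 hK) ?q_cons ?q_nil ?scaleN1r //; lia.
  + by lia.
  + by rewrite /adm /=; lia.
  rewrite /qwt /= !xwt_cons xwt_nil (_ : (k + 5 = k.+2 + 3)%N); last by lia.
  by rewrite lam3 -[k.+3]addn3 lam3 e; ring.
have [||c [p [h1 h2 h3 h4]]] := IH (k + 3)%N; try by lia.
exists c, ([:: k, k.+1 & p.1], p.2); split=> [N lN|//||].
- rewrite brN_vv_far; try by lia.
  by rewrite h1 // !q_cons -!scalerAr.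
(* The new indices k and k+1 are too small to affect admissibility, as [p.2] is at least k + 5. *)
- move: h3; rewrite /adm /= => /andP[-> h3].
  have [-> -> -> ->] : [/\ (k.+2 == p.2) = false, (k.+3 == p.2) = false,
    (k.+1 < p.2)%N & (k.+2 < p.2)%N] by split; lia.
  by have -> : (k.+4 == p.2) = false by lia.
by rewrite /qwt /= !xwt_cons; move: h4; rewrite /qwt lam3 => h4; lra.
Qed.

Lemma adm_lt a k : adm (a, k) -> all (fun i => i < k)%N a.
Proof. by move=> /andP[h _]; apply: sub_all h => i /= /ltnW. Qed.

(** V_k is bracketed either with x^b, keeping V_l, or with V_l. Both preserve admissibility and add
    the weights. *)
Lemma br_qq_form a k b l : (k <= l)%N -> adm (a, k) -> adm (b, l) ->
  exists L : seq (K * (seq nat * nat)),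
  br (q K a k) (q K b l) = \sum_(p <- L) p.1 *: q K p.2.1 p.2.2 /\
  forall p, p \in L -> adm p.2 /\ qwt p.2 = qwt (a, k) + qwt (b, l).
Proof.
move=> kl hA hB; have [La [h1 h2]] := brN_vxs_form k b.
have [c [p [g1 g2 g3 g4]]] := brN_vv_form kl.
exists ([seq (p.1, (a ++ p.2, l)) | p <- La] ++
        [:: ((-1) ^+ odd (size b) * c, (a ++ b ++ p.1, p.2))]); split.
  apply: (@br_eq_brN _ _ _ _ (l + 6)); try exact/tame_q/adm_lt.
  move=> N hN; rewrite brN_qv ?adm_lt //; last by lia.
  rewrite {1}/q (brN_Mr hK _ _ (par_Vw _ _) (par_xs _ _)) g1; last by lia.
  rewrite h1; last by move=> j /(allP (adm_lt hB)); lia.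
  rewrite mulrDr big_cat big_map big_seq1 /= !q_cat -!scalerAr scalerA; congr (_ + _ *: _).
  rewrite mulr_suml mulr_sumr; apply: eq_bigr => r _.
  by rewrite q_cat /q -scalerAl -scalerAr.
have /andP[/allP a1 a2] := hA; have /andP[/allP b1 b2] := hB; move: a1 a2 b1 b2 => /= a1 a2 b1 b2.
move=> r; rewrite mem_cat => /orP[/mapP[s /h2[[j jb kj] sb ws] -> /=]|].
  have jl := b1 _ jb.
  split; last by rewrite /qwt /= xwt_cat ws; ring.
  (* A contraction with x_j forces k <= j <= l - 2, so all indices not coming from b are below l - 3
     and only b can occupy the two critical places. *)
  have H i : i \in a ++ s.2 -> i \in b \/ (i.+3 < l)%N.
    rewrite mem_cat => /orP[/a1|/sb[|[j' /b1 j'l ij]]]; [|by left|]; by right; lia.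
  rewrite /adm; apply/andP; split.
    by apply/allP => i /H[/b1//|il] /=; lia.
  apply: contra b2 => /andP[/hasP[i /H[ib|il] /= il2] /hasP[i' /H[ib'|il'] /= il3]];
    [|by lia..].
  by apply/andP; split; apply/hasP; [exists i|exists i'].
rewrite inE => /eqP -> /=; split; last by rewrite /qwt /= !xwt_cat; move: g4; rewrite /qwt; lra.
move: g3; rewrite /adm /= !all_cat !has_cat => /andP[-> g3].
(* Here the pivot index has grown to at least l + 2, so the indices of a and b lie below the
   critical places. *)
have F (s : seq nat) : (forall i, i \in s -> (i.+1 < l)%N) ->
     [/\ all (fun i => i.+1 < p.2)%N s, has (fun i => i.+2 == p.2)%N s = false
       & has (fun i => i.+3 == p.2)%N s = false].
  move=> hs; split; first by apply/allP => i /hs; lia.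
    by apply/hasP => -[i /hs h /= e]; lia.
  by apply/hasP => -[i /hs h /= e]; lia.
have [i /a1 ia|-> -> ->] := F a; first by lia.
by have [i ib|-> -> ->] := F b; first exact: b1.
Qed.
End Closure.

(** * Filtration by weight, compatible with product and bracket *)

Section WeightFiltration.
Variable K : fieldType.
Local Notation W := (wfun K).
Local Notation x i := (gen K (false, i)).
Local Notation v i := (Vw K i).
Variables (R : realFieldType) (lam : R).

Definition prodq (L : seq (seq nat * nat)) : W := \prod_(p <- L) q K p.1 p.2.
Definition prodwt (L : seq (seq nat * nat)) : R := \sum_(p <- L) qwt lam p.
(** Distinct indices are needed for the lower bound on the weight; a repeated index makes the
    element zero. *)
Definition good (p : seq nat * nat) := adm p && uniq p.1.

Lemma prodq_cons p L : prodq (p :: L) = q K p.1 p.2 * prodq L. Proof. exact: big_cons. Qed.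
Lemma prodq_nil : prodq [::] = 1. Proof. exact: big_nil. Qed.
Lemma prodwt_cons p L : prodwt (p :: L) = qwt lam p + prodwt L. Proof. exact: big_cons. Qed.
Lemma prodwt_nil : prodwt [::] = 0. Proof. exact: big_nil. Qed.

Lemma good_adm p : good p -> adm (p.1, p.2).
Proof. by case: p => a k /andP[]. Qed.

Definition generators (t : R) (f : W) :=
  exists L, [/\ all good L, prodwt L <= t & f = prodq L].
Definition filt (t : R) (f : W) := lspan (generators t) f.

Lemma filt_le s t f : s <= t -> filt s f -> filt t f.
Proof.
move=> st; elim=> [|c g h [L [gL wL e]] _ IH]; first exact: Lspan0.
by apply: LspanC => //; exists L; split=> //; apply: le_trans st.
Qed.

Lemma filt_prodq L : all good L -> filt (prodwt L) (prodq L).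
Proof. by move=> gL; apply: lspan_in; exists L. Qed.

Lemma filt_q p : good p -> filt (qwt lam p) (q K p.1 p.2).
Proof.
move=> gp; have := @filt_prodq [:: p]; rewrite /= gp => /(_ isT).
by rewrite prodq_cons prodq_nil mulr1 prodwt_cons prodwt_nil addr0.
Qed.

Lemma filtM s t (f g : W) : filt s f -> filt t g -> filt (s + t) (f * g).
Proof.
apply: lspan_bilin.
- exact: mulrDl.
- exact: mulrDr.
- by move=> *; rewrite scalerAl.
- by move=> *; rewrite scalerAr.
move=> _ _ [L [gL wL ->]] [M [gM wM ->]]; apply: lspan_in; exists (L ++ M).
by rewrite all_cat gL gM /prodwt /prodq !big_cat /= lerD.
Qed.

Lemma tame_prodq L : all good L -> tame (prodq L).
Proof.
elim: L => [_|p L IH /= /andP[gp gL]]; first by rewrite prodq_nil; apply: tame1.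
rewrite prodq_cons; apply: tame_mul; last exact: IH.
by apply: tame_q; apply: adm_lt; apply: good_adm.
Qed.

Lemma alt_prodq L : alt (prodq L).
Proof.
elim: L => [|p L IH]; first by rewrite prodq_nil; apply: alt1.
by rewrite prodq_cons; apply: alt_mul => //; apply: alt_q.
Qed.

Lemma par_prodq L : exists p, par p (prodq L).
Proof.
elim: L => [|p L [r IH]]; first by exists false; rewrite prodq_nil; apply: par1.
by exists (~~ odd (size p.1) (+) r); rewrite prodq_cons; apply: par_mul => //; apply: par_q.
Qed.

Lemma filt_alt t f : filt t f -> alt f.
Proof.
elim=> [|c g h [L [_ _ ->]] _ IH]; first exact: alt0.
by apply: altD => //; apply: altZ; apply: alt_prodq.
Qed.

Lemma filt_sg t f : filt t f -> filt t (sg f).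
Proof.
elim=> [|c g h Sg _ IH]; first by rewrite linear0; apply: Lspan0.
rewrite linearD linearZ /=; apply: lspanD => //; apply: lspanZ.
have [L [gL wL ->]] := Sg; have [p ->] := par_prodq L.
by apply: lspanZ; apply: lspan_in; exists L.
Qed.

Hypothesis lamE : lam ^+ 3 = lam + 2.
Hypothesis hK : (2%:R : K) != 0.

Lemma filt_br_qq_le p r : (p.2 <= r.2)%N -> good p -> good r ->
  filt (qwt lam p + qwt lam r) (br (q K p.1 p.2) (q K r.1 r.2)).
Proof.
move=> pr gp gr.
have [L [-> hL]] := br_qq_form lamE hK pr (good_adm gp) (good_adm gr).
apply: lspan_sum => s /hL[as_ ws]; apply: lspanZ.
case: (boolP (uniq s.2.1)) => us; last first.
  by rewrite /q (xs_nuniq hK us) mul0r; apply: Lspan0.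
have gs : good s.2 by rewrite /good as_ us.
by have := filt_q gs; rewrite ws; case: p r {pr gp gr hL ws} => ? ? [? ?].
Qed.

Lemma filt_br_qq p r : good p -> good r ->
  filt (qwt lam p + qwt lam r) (br (q K p.1 p.2) (q K r.1 r.2)).
Proof.
move=> gp gr; case: (leqP p.2 r.2) => [le|/ltnW le]; first exact: filt_br_qq_le.
rewrite (br_sym hK (par_q _ _ _) (par_q _ _ _)) -scaleN1r addrC.
by do 2!apply: lspanZ; apply: filt_br_qq_le.
Qed.

Lemma br_1r (f : W) : br f 1 = 0.
Proof. by apply/funext => m; rewrite /br brN_1r. Qed.
Lemma br_1l (f : W) : br 1 f = 0.
Proof. by apply/funext => m; rewrite /br brN_1l. Qed.

Lemma filt_br_qprod p L : good p -> all good L ->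
  filt (qwt lam p + prodwt L) (br (q K p.1 p.2) (prodq L)).
Proof.
move=> gp; have tp : tame (q K p.1 p.2) by apply: tame_q; apply: adm_lt; apply: good_adm.
elim: L => [_|r L IH /= /andP[gr gL]]; first by rewrite prodq_nil br_1r; apply: Lspan0.
have tr : tame (q K r.1 r.2) by apply: tame_q; apply: adm_lt; apply: good_adm.
rewrite prodq_cons (br_Mr hK (par_q _ _ _) (par_q _ _ _)) //; last exact: tame_prodq.
rewrite prodwt_cons; apply: lspanD.
  by rewrite addrA; apply: filtM; [apply: filt_br_qq|apply: filt_prodq].
by rewrite addrCA; apply: lspanZ; apply: filtM; [apply: filt_q|apply: IH].
Qed.

Lemma filt_br_prod L M : all good L -> all good M ->
  filt (prodwt L + prodwt M) (br (prodq L) (prodq M)).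
Proof.
move=> + gM; have tM := tame_prodq gM; have [s pM] := par_prodq M.
elim: L => [_|p L IH /= /andP[gp gL]]; first by rewrite prodq_nil br_1l; apply: Lspan0.
have tp : tame (q K p.1 p.2) by apply: tame_q; apply: adm_lt; apply: good_adm.
have [r pL] := par_prodq L.
rewrite prodq_cons (br_Ml hK pL pM) //; last exact: tame_prodq.
rewrite prodwt_cons; apply: lspanD.
  by rewrite -addrA; apply: filtM; [apply: filt_q|apply: IH].
apply: lspanZ; rewrite addrAC; apply: filtM; last exact: filt_prodq.
exact: filt_br_qprod.
Qed.

Lemma filt_br s t (f g : W) : filt s f -> filt t g -> filt (s + t) (br f g).
Proof.
apply: lspan_bilin; [exact: br_Dl|exact: br_Dr|exact: br_Zl|exact: br_Zr|].
move=> _ _ [L [gL wL ->]] [M [gM wM ->]].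
by apply: filt_le (filt_br_prod gL gM); apply: lerD.
Qed.

Hypothesis lam1 : 1 <= lam.

(** The generators V_0, V_1, V_2 weigh at most [lam^2] and 1 weighs 0; weights add under product and
    bracket. *)
Lemma filt_wjeval w : filt (lam ^+ 2 * (jlen w)%:R) (wjeval K w).1 /\
                      filt (lam ^+ 2 * (jlen w)%:R) (wjeval K w).2.
Proof.
elim: w => [i|u [u1 u2] w [w1 w2]] /=.
  rewrite mulr1; case: ifP => i3 /=; split; try exact: Lspan0.
    have gi : good ([::], i) by [].
    have := filt_q gi; rewrite q_nil /= /qwt xwt_nil subr0; apply: filt_le => /=.
    by apply: ler_weXn2l => //; rewrite -ltnS.
  apply: lspan_in; exists [::]; rewrite prodwt_nil prodq_nil; split=> //.
  by rewrite exprn_ge0 // (le_trans ler01).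
rewrite natrD mulrDr; split; apply: lspanD.
- exact: filtM.
- by apply: filt_br => //; apply: filt_sg.
- by apply: filtM => //; apply: filt_sg.
exact: filtM.
Qed.

Lemma alt_wjeval w : alt (wjeval K w).2.
Proof. exact: filt_alt (filt_wjeval w).2. Qed.

End WeightFiltration.

(** * Lower bound for the weight of an admissible element *)

Section WeightBound.
Variables (R : realFieldType) (lam : R).
Hypothesis lamE : lam ^+ 3 = lam + 2.

Lemma lam_gt : 3 / 2 < lam.
Proof.
rewrite ltNge; apply/negP => h; have h0 : 0 <= 3 / 2 - lam by lra.
(* The product of the two nonnegative factors is 15/8 - (lam^3 - lam), which equals -1/8. *)
have hq : 0 <= lam ^+ 2 + 3 / 2 * lam + 5 / 4 by have := sqr_ge0 (lam + 3 / 4); lra.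
by have := mulr_ge0 h0 hq; move: lamE; lra.
Qed.

(** Equal to 1 - 1/lam^2 - 1/(lam^3 (lam - 1)) once [lam^3] is replaced by [lam + 2]; it is positive
    because lam > 3/2. *)
Definition wconst : R := (2 * lam - 3) / (lam ^+ 3 * (lam - 1)).

Lemma wconst_gt0 : 0 < wconst.
Proof.
have h := lam_gt; rewrite divr_gt0 ?mulr_gt0 ?exprn_gt0 //; lra.
Qed.

Lemma geom_sum n : (lam - 1) * \sum_(i <- iota 0 n) lam ^+ i = lam ^+ n - 1.
Proof.
elim: n => [|n IH]; first by rewrite big_nil mulr0 subrr.
by rewrite -addn1 iotaD big_cat /= big_seq1 mulrDr IH add0n addn1 exprS; ring.
Qed.

Lemma xwt_below a n : uniq a -> all (fun i => i < n)%N a ->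
  (lam - 1) * xwt lam a <= lam ^+ n.
Proof.
have h := lam_gt; move=> ua /allP an.
have le : xwt lam a <= \sum_(i <- iota 0 n) lam ^+ i.
  have p : perm_eq a [seq i <- iota 0 n | i \in a].
    apply: uniq_perm => //; first by rewrite filter_uniq ?iota_uniq.
    by move=> i; rewrite mem_filter mem_iota /=; case: (boolP (i \in a)) => // /an ->.
  rewrite /xwt (perm_big _ p) big_filter [X in _ <= X](bigID (mem a)) /= lerDl.
  by apply: sumr_ge0 => i _; rewrite exprn_ge0 //; lra.
have h1 : 0 <= lam - 1 by lra.
by have := ler_wpM2l h1 le; rewrite geom_sum => /le_trans -> //; rewrite gerBl.
Qed.

Lemma qwt_ge p : good p -> wconst * lam ^+ p.2 <= qwt lam p.
Proof.
case: p => a k /andP[/andP[/= a1 a2] ua].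
have h := lam_gt; have l0 : 0 < lam by lra.
(* Of k-2 and k-3 at most one occurs, with weight at most lam^(k-2); the indices below k-3
   contribute at most lam^(k-3)/(lam-1) by the geometric sum. *)
pose b := [seq i <- a | (i.+3 < k)%N]; pose c := [seq i <- a | ~~ (i.+3 < k)%N].
have e : xwt lam a = xwt lam b + xwt lam c.
  by rewrite /xwt (bigID (fun i => i.+3 < k)%N) /= !big_filter.
have hc : lam ^+ 2 * xwt lam c <= lam ^+ k.
  have c23 i : i \in c -> i \in a /\ (k = i.+2 \/ k = i.+3).
    by rewrite mem_filter => /andP[il ia]; split=> //; have := allP a1 _ ia; lia.
  have c1 i j : i \in c -> j \in c -> i = j.
    move=> /c23[ia ik] /c23[ja jk]; case: (eqVneq i j) => // ij.
    exfalso; move/negP: a2; apply; apply/andP.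
    case: ik jk => [ei|ei] [ej|ej].
    + by exfalso; move/eqP: ij; lia.
    + by split; apply/hasP; [exists i|exists j] => //=; lia.
    + by split; apply/hasP; [exists j|exists i] => //=; lia.
    by exfalso; move/eqP: ij; lia.
  have uc : uniq c by rewrite filter_uniq.
  case: c uc c1 c23 {e} => [|i [|j c]] uc c1 c23.
  - by rewrite xwt_nil mulr0 exprn_ge0 // ltW.
  - rewrite xwt_cons xwt_nil addr0 -exprD; apply: ler_weXn2l; first by lra.
    by have [_] := c23 i (mem_head _ _); lia.
  move: uc; rewrite (c1 i j) ?mem_head ?inE ?eqxx ?orbT //=.
  by rewrite !inE eqxx.
have hb : lam ^+ 3 * ((lam - 1) * xwt lam b) <= lam ^+ k.
  have ub : uniq b by rewrite filter_uniq.
  case: (ltnP k 3) => k3.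
    have -> : b = [::].
      by rewrite /b (@eq_filter _ _ pred0) ?filter_pred0 // => i /=; lia.
    by rewrite xwt_nil !mulr0 exprn_ge0 // ltW.
  have bk : all (fun i => i < k - 3)%N b.
    by apply/allP => i; rewrite mem_filter => /andP[]; lia.
  have := xwt_below ub bk; rewrite -(ler_pM2l (exprn_gt0 3 l0)) -exprD subnKC //.
rewrite /qwt /= e /wconst.
set P := lam ^+ k in hb hc *; set B := xwt lam b in hb *; set C := xwt lam c in hc *.
have d0 : 0 < lam ^+ 3 * (lam - 1) by rewrite mulr_gt0 ?exprn_gt0 //; lra.
rewrite mulrAC ler_pdivrMr // .
have hc' : (lam * (lam - 1)) * (lam ^+ 2 * C) <= (lam * (lam - 1)) * P.
  by apply: ler_wpM2l => //; apply: mulr_ge0; lra.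
have eP : P * (lam ^+ 3 * (lam - 1)) = P * ((lam + 2) * (lam - 1)) by rewrite lamE.
by move: hb hc' eP; lra.
Qed.
End WeightBound.

(** * Spans of products of anticommuting elements *)

Section MonomialSpan.
Variable K : fieldType.
Local Notation W := (wfun K).
Local Notation x i := (gen K (false, i)).
Local Notation v i := (Vw K i).

Fixpoint mons (gs : seq W) : seq W :=
  if gs is g :: r then [seq g * f | f <- mons r] ++ mons r else [:: 1].

(** Membership in the span of [mons gs], phrased so as to split off the first factor. *)
Fixpoint in_mons (gs : seq W) (f : W) : Prop :=
  if gs is g :: r then exists a b, [/\ in_mons r a, in_mons r b & f = g * a + b]
  else exists c : K, f = c *: 1.

Lemma size_mons gs : size (mons gs) = (2 ^ size gs)%N.
Proof. by elim: gs => //= g r IH; rewrite size_cat size_map IH addnn expnS mul2n. Qed.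

Lemma in_mons0 gs : in_mons gs 0.
Proof.
elim: gs => [|g r IH] /=; first by exists 0; rewrite scale0r.
by exists 0, 0; rewrite mulr0 addr0.
Qed.

Lemma in_monsD gs f h : in_mons gs f -> in_mons gs h -> in_mons gs (f + h).
Proof.
elim: gs f h => [|g r IH] f h /=.
  by move=> [c ->] [d ->]; exists (c + d); rewrite scalerDl.
move=> [a [b [ha hb ->]]] [a' [b' [ha' hb' ->]]]; exists (a + a'), (b + b').
by split; [exact: IH|exact: IH|rewrite mulrDr addrACA].
Qed.

Lemma in_monsZ gs c f : in_mons gs f -> in_mons gs (c *: f).
Proof.
elim: gs f => [|g r IH] f /=; first by move=> [d ->]; exists (c * d); rewrite scalerA.
move=> [a [b [ha hb ->]]]; exists (c *: a), (c *: b).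
by split; [exact: IH|exact: IH|rewrite scalerDr scalerAr].
Qed.

Lemma in_mons1 gs : in_mons gs 1.
Proof.
elim: gs => [|g r IH] /=; first by exists 1; rewrite scale1r.
by exists 0, 1; rewrite mulr0 add0r; split=> //; apply: in_mons0.
Qed.

Lemma in_mons_coef gs f : in_mons gs f -> exists2 c : seq K, size c = size (mons gs) &
  f = \sum_(p <- zip c (mons gs)) p.1 *: p.2.
Proof.
elim: gs f => [|g r IH] f /=; first by move=> [c ->]; exists [:: c]; rewrite ?big_seq1.
move=> [a [b [/IH[c sc ->] /IH[d sd ->] ->]]]; exists (c ++ d).
  by rewrite !size_cat size_map sc sd.
rewrite zip_cat ?size_map // big_cat mulr_sumr; congr (_ + _).
elim: c (mons r) {sc} => [|e c IHc] [|h m]; rewrite ?big_nil //= !big_cons IHc.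
by rewrite scalerAr.
Qed.

Hypothesis hK : (2%:R : K) != 0.

(** An odd g moves past the earlier factors up to sign and is absorbed by its own copy, as its
    square is zero. So n odd elements generate an algebra of dimension at most 2^n. *)
Lemma in_monsM gs g f : (forall h, List.In h gs -> par true h) -> List.In g gs ->
  in_mons gs f -> in_mons gs (g * f).
Proof.
elim: gs f => [|g0 r IH] f //= odd_gs gg [a [b [ha hb ->]]].
have o0 : par true g0 by apply: odd_gs; left.
case: gg => [<-|gr].
  exists b, 0; split=> //; first exact: in_mons0.
  by rewrite mulrDr mulrA (odd_sqr hK o0) mul0r add0r addr0.
have og : par true g by apply: odd_gs; right.
have odd_r h : List.In h r -> par true h by move=> hr; apply: odd_gs; right.
exists (-1 *: (g * a)), (g * b); split; [by apply: in_monsZ; apply: IH|exact: IH|].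
by rewrite mulrDr mulrA (odd_anticomm hK og o0) mulNr -mulrA scaleN1r mulrN.
Qed.

Definition vx_gens (M : nat) : seq W :=
  [seq v j | j <- iota 0 M] ++ [seq x i | i <- iota 0 M].

Lemma In_mem_map (A : eqType) (B : Type) (f : A -> B) s a : a \in s -> List.In (f a) (map f s).
Proof. by elim: s => //= b s IH; rewrite inE => /predU1P[->|/IH]; [left|right]. Qed.

Lemma vx_gens_odd M h : List.In h (vx_gens M) -> par true h.
Proof.
move=> hh; case: (@List.in_app_or _ _ _ _ hh) => h0; have [j _ ->] := In_map h0.
  exact: par_Vw.
exact: par_gen.
Qed.

Lemma in_mons_v M j f : (j < M)%N -> in_mons (vx_gens M) f -> in_mons (vx_gens M) (v j * f).
Proof.
move=> jM; apply: in_monsM; first exact: vx_gens_odd.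
apply: (@List.in_or_app _ _ _ _); left.
by apply: (In_mem_map (fun j => v j)); rewrite mem_iota.
Qed.

Lemma in_mons_x M j f : (j < M)%N -> in_mons (vx_gens M) f -> in_mons (vx_gens M) (x j * f).
Proof.
move=> jM; apply: in_monsM; first exact: vx_gens_odd.
apply: (@List.in_or_app _ _ _ _); right.
by apply: (In_mem_map (fun j => x j)); rewrite mem_iota.
Qed.

Lemma in_mons_q M a k f : all (fun i => i < k)%N a -> (k < M)%N ->
  in_mons (vx_gens M) f -> in_mons (vx_gens M) (q K a k * f).
Proof.
move=> + kM hf; elim: a => [_|i a IH /= /andP[ik ak]].
  by rewrite q_nil; apply: in_mons_v.
by rewrite q_cons -mulrA; apply: in_mons_x; [exact: ltn_trans kM|exact: IH].
Qed.

Variables (R : realFieldType) (lam : R).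
Hypothesis lamE : lam ^+ 3 = lam + 2.

(** All weights are nonnegative, so each factor x^a V_k of a product weighs less than
    [wconst lam * lam ^+ M], which forces k < M. *)
Lemma filt_in_mons M t f : t < wconst lam * lam ^+ M -> filt lam t f ->
  in_mons (vx_gens M) f.
Proof.
have lam1 := lam_gt lamE; have c0 := wconst_gt0 lamE.
have l0 : 0 < lam by lra.
move=> tM; elim=> [|c g h [L [gL wL ->]] _ IH]; first exact: in_mons0.
apply: in_monsD => //; apply: in_monsZ.
have pos p : good p -> 0 <= qwt lam p.
  move=> /(qwt_ge lamE); apply: le_trans.
  by rewrite mulr_ge0 ?exprn_ge0 // ltW.
have {}wL : prodwt lam L < wconst lam * lam ^+ M by apply: le_lt_trans tM.
elim: L gL wL => [_ _|p L IHL /= /andP[gp gL]]; first by rewrite prodq_nil; apply: in_mons1.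
rewrite prodwt_cons prodq_cons => wL.
have wL0 : 0 <= prodwt lam L.
  by rewrite /prodwt big_seq; apply: sumr_ge0 => r /(allP gL) /pos.
have := pos p gp => p0; have := qwt_ge lamE gp => hp.
apply: in_mons_q.
- by apply: adm_lt; apply: good_adm.
- rewrite -(@ltr_eXn2l _ lam); last by lra.
  by rewrite -(ltr_pM2l c0); lra.
by apply: IHL => //; lra.
Qed.
End MonomialSpan.

(** * Upper bounds for the dimension of a span *)

Section SpanDimUpper.
Variable K : fieldType.

Lemma sum_zip_nth (T : Type) (t0 : T) (c : seq K) (B : seq T) (F : T -> K) :
  size c = size B ->
  \sum_(p <- zip c B) p.1 * F p.2 = \sum_(j < size B) c`_j * F (nth t0 B j).
Proof.
move=> sc; rewrite (big_nth (0, t0)) size_zip sc minnn big_mkord.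
by apply: eq_bigr => j _; rewrite nth_zip.
Qed.

(** An independent sublist longer than B would have a coefficient matrix with more rows than
    columns; a nonzero vector of its left kernel is a dependence. *)
Lemma span_dim_le (L B : seq (kelt K)) :
  (forall t, t \in L -> exists2 c : seq K, size c = size B &
     forall m, t.1 m = \sum_(p <- zip c B) p.1 * p.2.1 m /\
               t.2 m = \sum_(p <- zip c B) p.1 * p.2.2 m) ->
  (span_dim L <= size B)%N.
Proof.
move=> h; rewrite /span_dim; apply/bigmax_leqP_seq => ms _ /asboolP li.
rewrite leqNgt; apply/negP => lt; set T := mask ms L in li lt.
pose t0 : kelt K := (e_zero K, e_zero K).
have /choice[cf hcf] : forall i : 'I_(size T), exists c : seq K, size c = size B /\
    forall m, (nth t0 T i).1 m = \sum_(p <- zip c B) p.1 * p.2.1 m /\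
              (nth t0 T i).2 m = \sum_(p <- zip c B) p.1 * p.2.2 m.
  move=> i; have /h[c sc hc] : nth t0 T i \in L by apply: (mem_mask (m := ms)); rewrite mem_nth.
  by exists c.
pose C := \matrix_(i < size T, j < size B) (cf i)`_j.
have nf : kermx C != 0.
  rewrite kermx_eq0 /row_free; apply/negP => /eqP rC.
  by have := rank_leq_col C; rewrite rC leqNgt lt.
have /rowV0Pn[u /sub_kermxP uC u0] := nf.
pose c := [seq u 0 i | i <- enum 'I_(size T)].
have sc : size c = size T by rewrite size_map size_enum_ord.
have cE (i : 'I_(size T)) : c`_i = u 0 i.
  by rewrite (nth_map i) ?size_enum_ord // nth_ord_enum.
have key (F : kelt K -> K) :
    (forall i : 'I_(size T), F (nth t0 T i) = \sum_(p <- zip (cf i) B) p.1 * F p.2) ->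
    \sum_(p <- zip c T) p.1 * F p.2 = 0.
  move=> hF; rewrite (sum_zip_nth t0) //.
  transitivity (\sum_(j < size B) (u *m C) 0 j * F (nth t0 B j)); last first.
    by rewrite uC big1 // => j _; rewrite mxE mul0r.
  under eq_bigr => i _ do rewrite cE hF (sum_zip_nth t0 _ (hcf i).1) mulr_sumr.
  rewrite exchange_big; apply: eq_bigr => j _; rewrite mxE mulr_suml.
  by apply: eq_bigr => i _; rewrite mxE mulrA.
have /allP c0 : all (fun a => a == 0) c.
  apply: li => // m; split.
    by apply: (key (fun t => t.1 m)) => i; have [] := (hcf i).2 m.
  by apply: (key (fun t => t.2 m)) => i; have [] := (hcf i).2 m.
move/eqP: u0; apply; apply/rowP => i; rewrite mxE -cE; apply/eqP/c0.
by rewrite mem_nth // sc.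
Qed.
End SpanDimUpper.

(** * The upper bound for the growth function *)

Section UpperBound.
Variables (K : fieldType) (R : realFieldType) (lam : R).
Hypothesis lamE : lam ^+ 3 = lam + 2.
Hypothesis hK : (2%:R : K) != 0.
Local Notation W := (wfun K).

Lemma restr_sum (c : seq K) (B : seq W) m : restr (\sum_(p <- zip c B) p.1 *: p.2) m =
  \sum_(p <- zip c B) p.1 * restr p.2 m.
Proof.
rewrite /restr; case: ifP => _; last by rewrite big1 // => p _; rewrite mulr0.
by rewrite wfun_sumE; apply: eq_bigr => p _; rewrite wscaleE.
Qed.

Lemma big_zip_mapr (A B : Type) (c : seq K) (s : seq A) (g : A -> B) (F : B -> K) :
  \sum_(p <- zip c (map g s)) p.1 * F p.2 = \sum_(p <- zip c s) p.1 * F (g p.2).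
Proof.
elim: c s => [|e c IH] [|a s]; rewrite ?big_nil //=.
by rewrite !big_cons IH.
Qed.

Lemma gamma_le n M : lam ^+ 2 * n%:R < wconst lam * lam ^+ M ->
  (gamma K n <= 2 * 4 ^ M)%N.
Proof.
move=> nM; have lam1 : 1 <= lam by have := lam_gt lamE; lra.
pose B0 := mons (vx_gens K M).
(* The two components of the Kantor double account for the factor 2, the 2M elements x_i and V_i
   with i < M for the factor 4^M. *)
pose B : seq (kelt K) :=
  [seq (restr f, e_zero K) | f <- B0] ++ [seq (e_zero K, restr f) | f <- B0].
have -> : (2 * 4 ^ M = size B)%N.
  rewrite size_cat !size_map size_mons /vx_gens size_cat !size_map !size_iota.
  by rewrite addnn -muln2 mulnC addnn -mul2n expnM.
apply: span_dim_le => t /mapP[w wn ->].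
have hw (f : W) : filt lam (lam ^+ 2 * (jlen w)%:R) f -> in_mons (vx_gens K M) f.
  apply: filt_in_mons => //; apply: le_lt_trans nM; rewrite ler_wpM2l ?ler_nat //.
    by rewrite exprn_ge0 //; lra.
  exact: jlen_jwords.
have [/hw/in_mons_coef[c sc ec] /hw/in_mons_coef[d sd ed]] := filt_wjeval lamE hK lam1 w.
exists (c ++ d); first by rewrite !size_cat !size_map sc sd.
have -> : jeval K w = (restr (wjeval K w).1, restr (wjeval K w).2).
  by apply: jeval_restr => // u; apply: (alt_wjeval lamE hK lam1).
move=> m; rewrite /= ec ed !restr_sum zip_cat ?size_map // !big_cat /=.
rewrite (big_zip_mapr c B0 _ (fun t : kelt K => t.1 m)) (big_zip_mapr d B0 _ (fun t : kelt K => t.1 m)).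
rewrite (big_zip_mapr c B0 _ (fun t : kelt K => t.2 m)) (big_zip_mapr d B0 _ (fun t : kelt K => t.2 m)) /=.
have z (e : seq K) : \sum_(p <- zip e B0) p.1 * e_zero K m = 0.
  by rewrite big1 // => p _; rewrite mulr0.
by rewrite !z addr0 add0r.
Qed.
End UpperBound.

(** * Asymptotics *)

Section Asymptotics.
Variables (K : fieldType) (R : realType) (lam : R).
Hypothesis lamE : lam ^+ 3 = lam + 2.
Hypothesis hK : (2%:R : K) != 0.

Lemma lam_gt1 : 1 < lam. Proof. by have := lam_gt lamE; lra. Qed.
Lemma ln_lam_gt0 : 0 < ln lam. Proof. exact: ln_gt0 lam_gt1. Qed.

Lemma ln_gamma_le : exists C : R, forall n, (0 < n)%N ->
  ln (gamma K n)%:R <= C + 2 * ln 2 / ln lam * ln (n%:R : R).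
Proof.
have l0 := ln_lam_gt0; have l1 := lam_gt1; have c0 := wconst_gt0 lamE.
(* A absorbs the constant factor between [lam ^+ 2 * n] and [lam ^+ M]; M is the first integer above
   [(ln n + A) / ln lam]. *)
pose A : R := `|2 * ln lam - ln (wconst lam)|.
exists (ln 2 + 2 * ln 2 * (A / ln lam + 1)) => n n0.
have nR : 0 < (n%:R : R) by rewrite ltr0n.
have lnn : 0 <= ln (n%:R : R) by rewrite ln_ge0 // ler1n.
have A0 : 0 <= A by rewrite normr_ge0.
pose y := (ln (n%:R : R) + A) / ln lam.
have y0 : 0 <= y by rewrite divr_ge0 ?addr_ge0 // ltW.
have [M My MY] : exists2 M : nat, y < M%:R & M%:R <= y + 1.
  have /andP[ty yt] := truncn_itv y0.
  by exists (Num.truncn y).+1; rewrite // -natr1 lerD2r.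
have lamM : lam ^+ 2 * n%:R < wconst lam * lam ^+ M.
  have lp : 0 < lam by lra.
  have p1 : 0 < lam ^+ 2 * (n%:R : R) by rewrite mulr_gt0 ?exprn_gt0.
  have p2 : 0 < wconst lam * lam ^+ M by rewrite mulr_gt0 ?exprn_gt0.
  rewrite -ltr_ln ?posrE //.
  have -> : ln (lam ^+ 2 * (n%:R : R)) = 2 * ln lam + ln (n%:R : R).
    by rewrite lnM ?posrE ?exprn_gt0 // lnXn // mulr_natl.
  have -> : ln (wconst lam * lam ^+ M) = ln (wconst lam) + M%:R * ln lam.
    by rewrite lnM ?posrE ?exprn_gt0 // lnXn // mulr_natl.
  move: My; rewrite ltr_pdivrMr //.
  have : 2 * ln lam - ln (wconst lam) <= A by rewrite ler_norm.
  by move: (M%:R : R) => r; lra.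
have l2 : 0 < ln (2 : R) by rewrite ln_gt0 //; lra.
have g : ln (gamma K n)%:R <= ln (2 : R) + 2 * ln 2 * M%:R.
  have M0 : 0 <= (M%:R : R) by [].
  have := gamma_le lamE hK lamM; case: (gamma K n) => [_|g gM].
    (* A value 0 of [gamma] is covered by the convention that [ln 0] is 0. *)
    rewrite ln0 // addr_ge0 ?mulr_ge0 //; lra.
  have -> : ln (2 : R) + 2 * ln 2 * M%:R = ln ((2 * 4 ^ M)%N%:R).
    rewrite natrM natrX lnM ?posrE ?exprn_gt0 // lnXn //.
    have -> : (4%:R : R) = 2 * 2 by rewrite -natrM.
    by rewrite lnM ?posrE // -mulr_natr; ring.
  by rewrite ler_ln ?posrE ?ltr0n ?muln_gt0 ?expn_gt0 // ler_nat.
apply: (le_trans g).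
have := ler_wpM2l (ltW (mulr_gt0 (ltr0n _ 2) l2)) MY.
rewrite /y; have -> : (ln (n%:R : R) + A) / ln lam = ln (n%:R : R) / ln lam + A / ln lam.
  by rewrite mulrDl.
have -> : 2 * ln 2 / ln lam * ln (n%:R : R) = 2 * ln 2 * (ln (n%:R : R) / ln lam).
  by rewrite -!mulrA; congr (_ * (_ * _)); rewrite mulrC.
by lra.
Qed.

Lemma cost_le k : ((cost k)%:R : R) <= 3 * lam ^+ k.
Proof.
have l1 := lam_gt1; elim/ltn_ind: k => k IH.
have [k3|k3] := ltnP k 3.
  have -> : cost k = 3%N by case: k k3 {IH} => [|[|[|]]].
  by rewrite ler_peMr // exprn_ege1 // ltW.
case: k k3 IH => [|[|[|k]]] // _ IH; rewrite costS3.
have h1 := IH k; have h2 := IH k.+1.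
rewrite natrD natrM -[k.+3]addn3 (lam3 lamE).
have := h1 ltac:(lia); have := h2 ltac:(lia); lra.
Qed.

(** The geometric sum is at most lam^k/(lam - 1), hence at most 2 lam^k because lam > 3/2. *)
Lemma sum_cost_le k : ((\sum_(j <- iota 0 k) cost j)%N%:R : R) <= 6 * lam ^+ k.
Proof.
have h := lam_gt lamE.
have le : ((\sum_(j <- iota 0 k) cost j)%N%:R : R) <= 3 * \sum_(j <- iota 0 k) lam ^+ j.
  by rewrite natr_sum mulr_sumr; apply: ler_sum => j _; apply: cost_le.
apply: (le_trans le); have := geom_sum lam k.
have s0 : 0 <= \sum_(j <- iota 0 k) lam ^+ j.
  by apply: sumr_ge0 => j _; rewrite exprn_ge0 //; lra.
have : 0 <= (lam - 3 / 2) * \sum_(j <- iota 0 k) lam ^+ j by rewrite mulr_ge0 //; lra.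
lra.
Qed.

Lemma ln_gamma_ge : exists C D : R, forall n, D <= n%:R ->
  2 * ln 2 / ln lam * ln (n%:R : R) - C <= ln (gamma K n)%:R.
Proof.
have l0 := ln_lam_gt0; have l1 := lam_gt1.
have lp : 0 < lam by lra.
have l2 : 0 < ln (2 : R) by rewrite ln_gt0 //; lra.
(* D lam^(3m) bounds the length needed in [gamma_ge]: 3 lam^(3m+12) for V_{3m+12} and 6 lam^(3m) for
   the V_j. The number m is taken maximal with D lam^(3m) <= n. *)
pose D := 3 * lam ^+ 12 + 6.
have lam12 : 0 < lam ^+ 12 by rewrite exprn_gt0.
have D0 : 1 <= D by rewrite /D; lra.
(* The term [6 * ln 2] pays for rounding m down. *)
exists (2 * ln 2 * (ln D / ln lam) + 6 * ln 2), D => n Dn.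
have nR : 0 < (n%:R : R) by lra.
pose y := (ln (n%:R : R) - ln D) / (3 * ln lam).
have y0 : 0 <= y.
  apply: divr_ge0; last by rewrite mulr_ge0 // ltW.
  by rewrite subr_ge0 ler_ln ?posrE //; lra.
have [m my ym] : exists2 m : nat, m%:R <= y & y < m%:R + 1.
  by have /andP[ty yt] := truncn_itv y0; exists (Num.truncn y); rewrite // natr1.
have hm : (cost (3 * m + 12) + \sum_(j <- iota 0 (3 * m)) cost j <= n)%N.
  rewrite -(ler_nat R) natrD.
  have h1 := cost_le (3 * m + 12); have h2 := sum_cost_le (3 * m).
  have h3 : D * lam ^+ (3 * m) <= n%:R.
    rewrite -ler_ln ?posrE ?mulr_gt0 ?exprn_gt0 //; try by lra.
    rewrite lnM ?posrE ?exprn_gt0 //; last by lra.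
    rewrite lnXn // -[ln lam *+ _]mulr_natl natrM.
    by move: my; rewrite ler_pdivlMr ?mulr_gt0 //; lra.
  by move: h1 h3; rewrite /D exprD; lra.
have := gamma_ge hK (alt_wjeval lamE hK (ltW l1)) hm => g.
have lg : 6 * m%:R * ln (2 : R) <= ln (gamma K n)%:R.
  have -> : 6 * m%:R * ln (2 : R) = ln ((2 ^ (6 * m))%N%:R).
    by rewrite natrX lnXn // -[ln _ *+ _]mulr_natl natrM.
  have gp : (0 < gamma K n)%N by apply: leq_trans g; rewrite expn_gt0.
  by rewrite ler_ln ?posrE ?ltr0n ?expn_gt0 // ler_nat.
apply: le_trans lg.
have : 6 * ln (2 : R) * y <= 6 * ln 2 * (m%:R + 1).
  by rewrite ler_wpM2l ?mulr_ge0 ?ltW.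
have -> : 6 * ln (2 : R) * y = 2 * ln 2 / ln lam * ln (n%:R : R) - 2 * ln 2 * (ln D / ln lam).
  by rewrite /y; field; rewrite gt_eqF.
lra.
Qed.

(** [ln (gamma K n)] differs from the limit times [ln n] by a bounded amount, which disappears after
    division by [ln n]. *)
Lemma GK_ratio_cvg : (GK_ratio K R @ \oo --> (2 * ln 2 / ln lam)%:E)%classic.
Proof.
apply: cvg_EFin; first exact: nearW.
have [C hC] := ln_gamma_le; have [C' [D hD]] := ln_gamma_ge.
apply/cvgrPdist_le => e e0.
pose A : R := `|C| + `|C'|.
near=> n; rewrite /= /GK_ratio /=.
have n2 : (2 <= n)%N by near: n; apply: nbhs_infty_ge.
have nD : D <= n%:R by near: n; apply: nbhs_infty_ger.
(* This makes [ln n] at least A / e, so that an additive error A becomes at most e in the ratio. *)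
have nA : expR (A / e) <= n%:R by near: n; apply: nbhs_infty_ger.
have nR : 0 < (n%:R : R) by rewrite ltr0n; lia.
have ln0' : 0 < ln (n%:R : R) by rewrite ln_gt0 // ltr1n.
have lA : A / e <= ln (n%:R : R).
  by rewrite -[A / e]expRK ler_ln ?posrE ?expR_gt0.
have up := hC n ltac:(lia); have lo := hD n nD.
set L := 2 * ln 2 / ln lam in up lo *.
have hA : A <= e * ln (n%:R : R) by move: lA; rewrite ler_pdivrMr // mulrC.
have cA : C <= A by rewrite /A; have := ler_norm C; have := normr_ge0 C'; lra.
have cA' : C' <= A by rewrite /A; have := ler_norm C'; have := normr_ge0 C; lra.
rewrite ler_norml; apply/andP; split.
  rewrite lerBrDr -lerBrDl opprK ler_pdivrMr // mulrDl; lra.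
rewrite lerBlDr -lerBlDl ler_pdivlMr // mulrBl; lra.
Unshelve. all: by end_near. Qed.
End Asymptotics.

Theorem theorem12p10 (K : fieldType) (hK : (2%:R : K) != 0)
  (R : realType) (lam : R) (hlam : lam ^+ 3 - lam - 2 = 0) :
  limn_esup (GK_ratio K R) = (2 * ln 2 / ln lam)%:E /\
  limn_einf (GK_ratio K R) = (2 * ln 2 / ln lam)%:E.
Proof.
have lamE : lam ^+ 3 = lam + 2 by lra.
by have [-> ->] := cvg_limn_einf_sup (GK_ratio_cvg lamE hK).
Qed.
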